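(* Let $\mathcal{H}$ be a complex separable Hilbert space, let $U:\mathcal{H}\to\mathcal{H}$ be unitary, let $\psi\in\mathcal{H}$ with $\|\psi\|=1$, let $d\ge 1$ be an integer, and let $(\varphi_n)_{n\in A}$ be an orthonormal basis of $\mathcal{H}$ indexed by $A=\mathbb{Z}_+^d$ or $A=\mathbb{Z}^d$. Suppose that $P_{\alpha c}\psi\ne0$ for some $\alpha\in[0,1]$. Then for each $p>0$ there exists a constant $C_{\psi,p}>0$ such that for every integer $K>0$, $$\big\langle|X|^p_\psi\big\rangle(K)>C_{\psi,p}\,K^{\alpha p/d}.$$
   Context: Notation: $\mathbb{Z}_+=\{1,2,3,\dots\}$; for $n\in A$, $|n|=|n_1|+\dots+|n_d|$. $\partial\mathbb{D}=\{z\in\mathbb{C}:|z|=1\}$. Spectral measure: for $\phi\in\mathcal{H}$, $\mu_\phi$ is the finite Borel measure on $\partial\mathbb{D}$ with $\langle\phi,f(U)\phi\rangle=\int f\,d\mu_\phi$ for all bounded Borel $f$ on $\partial\mathbb{D}$. Hausdorff measure: for $\alpha\ge0$ and $E\subseteq\partial\mathbb{D}$, $h^\alpha(E)=\lim_{\delta\to0^+}\inf\sum_n(\operatorname{diam}S_n)^\alpha$, where the infimum is over countable families $(S_n)$ of subsets of $\partial\mathbb{D}$ with $\operatorname{diam}S_n<\delta$ for all $n$ and $E\subseteq\bigcup_nS_n$. A measure $\mu$ on $\partial\mathbb{D}$ is $\alpha$-continuous if $\mu(E)=0$ for all $E\subseteq \partial\mathbb{D}$ with $h^\alpha(E)=0$;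 it is $\alpha$-singular if it is supported on a set of zero $h^\alpha$ measure. $\mathcal{H}_{\alpha c}=\{\phi\in\mathcal{H}:\mu_\phi\text{ is }\alpha\text{-continuous}\}$ and $\mathcal{H}_{\alpha s}=\{\phi\in\mathcal{H}:\mu_\phi\text{ is }\alpha\text{-singular}\}$ are closed, mutually orthogonal subspaces with $\mathcal{H}=\mathcal{H}_{\alpha c}\oplus\mathcal{H}_{\alpha s}$; $P_{\alpha c}$ denotes the orthogonal projection onto $\mathcal{H}_{\alpha c}$. Dynamics: $\psi(k)=U^k\psi$, $a_\psi(n,k)=|\langle\varphi_n,\psi(k)\rangle|^2$, $|X|^p_\psi(k)=\sum_{n\in A}(|n|^p+1)\,a_\psi(n,k)\in[1,\infty]$, and $\langle|X|^p_\psi\rangle(K)=\frac1K\sum_{k=0}^{K-1}|X|^p_\psi(k)$. *)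

(* Defs.v *)
From HB Require Import structures.
From mathcomp Require Import all_boot all_order all_algebra.
From mathcomp Require Import sesquilinear.
From mathcomp Require Import complex.
From mathcomp Require Import all_classical all_reals all_analysis.

Set Implicit Arguments.
Unset Strict Implicit.
Unset Printing Implicit Defensive.

Import Order.TTheory GRing.Theory Num.Theory.
Import numFieldNormedType.Exports.

Local Open Scope classical_set_scope.
Local Open Scope ring_scope.
Local Open Scope complex_scope.

(* The real-valued modulus; `|z| itself lives in R[i]. *)
Definition cmod (R : realType) (z : R[i]) : R := ComplexField.Normc.normc z.

Section UnitCircle.
Variable R : realType.

Definition circle_set : set (R[i]^o) := [set z | cmod z = 1].

Definition circle : Type := circle_set.

HB.instance Definition _ := Topological.on circle.

Definition cval (t : circle) : R[i] := set_val t.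

Lemma circle_set1 : (1 : R[i]^o) \in circle_set.
Proof. by rewrite inE; exact: ComplexField.Normc.normc1. Qed.

HB.instance Definition _ :=
  isPointed.Build circle (exist (fun z => z \in circle_set) 1 circle_set1).

Definition borel_circle := g_sigma_algebraType (@open circle).

Definition bounded_borel (f : borel_circle -> R[i]) : Prop :=
  [/\ measurable_fun setT (fun t => complex.Re (f t)),
      measurable_fun setT (fun t => complex.Im (f t)) &
      exists M : R, forall t, cmod (f t) <= M].

Definition Cintegral (mu : {finite_measure set borel_circle -> \bar R})
    (f : borel_circle -> R[i]) : R[i] :=
  (\int[mu]_t complex.Re (f t)) +i* (\int[mu]_t complex.Im (f t)).

(* Distances on the circle are at most 2, so the real supremum is the true one;
   sup set0 = 0 gives the usual convention for the empty set. *)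
Definition diam (S : set circle) : R :=
  sup [set r | exists x y, [/\ S x, S y & r = cmod (cval x - cval y)]].

(* A countable, possibly finite, family is indexed by a set I of naturals.
   Note that 0 `^ 0 = 1, so that the 0-dimensional measure is counting. *)
Definition hausdorff_content (alpha delta : R) (E : set circle) : \bar R :=
  ereal_inf [set s | exists (I : set nat) (S : nat -> set circle),
    [/\ forall n, I n -> diam (S n) < delta,
        E `<=` \bigcup_(n in I) S n &
        s = \esum_(n in I) (diam (S n) `^ alpha)%:E]].

Definition hausdorff_measure (alpha : R) (E : set circle) : \bar R :=
  lim (hausdorff_content alpha delta E @[delta --> 0^'+]).

(* E need not be Borel: mu E = 0 is read in the completion of mu. *)
Definition alpha_continuous (alpha : R)
    (mu : {finite_measure set borel_circle -> \bar R}) : Prop :=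
  forall E : set circle, hausdorff_measure alpha E = 0%E -> mu.-negligible E.

End UnitCircle.

Section Hilbert.
Variables (R : realType) (H : completeNormedModType R[i]).
Variable dot : {dot H for (@Num.conj R[i])}.

(* Forms in the library are linear on the left; the bracket below is linear in
   its second argument. *)
Definition inner (x y : H) : R[i] := dot y x.

(* H is a Hilbert space for [inner]; completeness is part of its type. *)
Definition norm_from_inner : Prop :=
  forall x : H, `|x| ^+ 2 = inner x x.

Definition unitary_operator (U : {linear H -> H}) : Prop :=
  bijective U /\ forall x y, inner (U x) (U y) = inner x y.

(* The bounded Borel functional calculus f |-> f(U), as characterized by the
   spectral theorem; there is exactly one such F for U unitary, up to its values
   on functions that are not bounded Borel. *)
Record borel_calculus (U : H -> H)
    (F : (borel_circle R -> R[i]) -> H -> H) : Prop := {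
  calculus_linear : forall f, bounded_borel f ->
    forall a x y, F f (a *: x + y) = a *: F f x + F f y ;
  calculusD : forall a f g, bounded_borel f -> bounded_borel g ->
    forall x, F (fun t => a * f t + g t) x = a *: F f x + F g x ;
  calculusM : forall f g, bounded_borel f -> bounded_borel g ->
    forall x, F (fun t => f t * g t) x = F f (F g x) ;
  calculus_adj : forall f, bounded_borel f ->
    forall x y, inner (F f x) y = inner x (F (fun t => Num.conj (f t)) y) ;
  calculus1 : forall x, F (fun=> 1) x = x ;
  calculus_id : forall x, F (fun t => cval t) x = U x ;
  calculus_norm : forall f (M : R), bounded_borel f ->
    (forall t, cmod (f t) <= M) -> forall x, `|F f x| <= M%:C * `|x| ;
  calculus_cvg : forall (f_ : nat -> borel_circle R -> R[i]) f (M : R),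
    (forall n, bounded_borel (f_ n)) -> bounded_borel f ->
    (forall n t, cmod (f_ n t) <= M) ->
    (forall t, (fun n => f_ n t : R[i]^o) @ \oo --> (f t : R[i]^o)) ->
    forall x, (fun n => F (f_ n) x) @ \oo --> F f x }.

Definition spectral_measure (U : H -> H) (phi : H)
    (mu : {finite_measure set (borel_circle R) -> \bar R}) : Prop :=
  exists2 F, borel_calculus U F &
    forall f, bounded_borel f -> inner phi (F f phi) = Cintegral mu f.

Definition H_ac (U : H -> H) (alpha : R) : set H :=
  [set phi | exists2 mu, spectral_measure U phi mu & alpha_continuous alpha mu].

(* For a closed subspace S the point below exists and is unique. *)
Definition ortho_proj (S : set H) (x : H) : H :=
  xget 0 [set y | S y /\ forall z, S z -> inner z (x - y) = 0].

Definition P_ac (U : H -> H) (alpha : R) : H -> H := ortho_proj (H_ac U alpha).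

Definition separable (T : topologicalType) : Prop :=
  exists2 D : set T, countable D & dense D.

Definition lin_span (I : eqType) (A : set I) (e : I -> H) : set H :=
  [set x | exists (s : seq I) (c : I -> R[i]),
    (forall i, i \in s -> A i) /\ x = \sum_(i <- s) c i *: e i].

Definition orthonormal_basis (I : eqType) (A : set I) (e : I -> H) : Prop :=
  (forall m n, A m -> A n -> inner (e m) (e n) = (m == n)%:R) /\
  dense (lin_span A e).

Section Dynamics.
Variables (d : nat) (A : set {ffun 'I_d -> int}).
Variables (e : {ffun 'I_d -> int} -> H) (U : H -> H) (psi : H).

Definition site_norm (n : {ffun 'I_d -> int}) : nat := (\sum_i `|n i|)%N.

Definition site_prob (n : {ffun 'I_d -> int}) (k : nat) : R :=
  cmod (inner (e n) (iter k U psi)) ^+ 2.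

Definition moment (p : R) (k : nat) : \bar R :=
  \esum_(n in A) (((site_norm n)%:R `^ p + 1) * site_prob n k)%:E.

Definition avg_moment (p : R) (K : nat) : \bar R :=
  ((K%:R^-1)%:E * \sum_(k < K) moment p k)%E.

End Dynamics.

End Hilbert.

Definition Zplus_lattice (d : nat) : set {ffun 'I_d -> int} :=
  [set n | forall i, (0 < n i)%R].

Arguments Zplus_lattice : clear implicits.

(* Main.v *)
Require Import Defs.
From mathcomp Require Import all_boot all_order all_algebra.
From mathcomp Require Import sesquilinear complex.
From mathcomp Require Import all_classical all_reals all_analysis.
From mathcomp Require Import measurable_realfun.
From mathcomp Require Import ring lra zify.
Import Order.TTheory GRing.Theory Num.Theory.
Import numFieldNormedType.Exports.
Import ComplexField.Normc.
Set Implicit Arguments.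
Unset Strict Implicit.
Unset Printing Implicit Defensive.
Local Open Scope classical_set_scope.
Local Open Scope ring_scope.
Local Open Scope complex_scope.

(** The theorem is a quantitative form of the RAGE philosophy: a state with an
alpha-continuous component cannot keep its mass on few basis vectors.

Let [y] be the projection of [psi] on the alpha-continuous subspace.  The inner
product of [y] and [psi] is the squared norm of [y], hence nonzero, and the
spectral measure [mu] of [y] is alpha-continuous.

1. Regularisation (Rogers and Taylor).  The points around which the dyadic arcs
   carry too much [mu]-mass form a set of zero alpha-dimensional Hausdorff
   measure, which is therefore [mu]-negligible.  Up to arbitrarily small mass,
   [mu] lives on a Borel set [S] such that the part in [S] of an arc of level
   [k] has mass at most [B * 2 ^ (- k alpha)] ([rogers_taylor]).  The vector
   [eta = 1_S(U) y] is close to [y], hence still not orthogonal to [psi]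
   ([holder_component]).

2. Decay of averages (Strichartz).  For every [x], the sum over [k < K] of
   [|<x, U^k eta>|^2] is at most [D * K ^ (1 - alpha) * |x|^2]
   ([orbit_decay]).  By duality ([dual_bessel]) this is the inequality
   [|\sum_k c_k U^k eta|^2 <= L * \sum_k |c_k|^2], whose left-hand side is the
   integral over [S] of [|p|^2] with [p(z) = \sum_k c_k z^k].  So it is a
   large sieve inequality ([large_sieve]).  It is proved without integrating
   along the circle: on an arc much shorter than [1/K] the polynomial [p] is
   controlled by its Taylor coefficients at one root of unity, and Parseval's
   identity for the roots of unity sums these over all arcs.

3. Counting.  The inner product of [U^k eta] and [U^k psi] does not depend on
   [k].  It splits into the contribution of a finite set [s] of sites, which by
   (2) is small on average as long as [s] has at most [c K ^ alpha] elements,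
   and a contribution bounded by the mass of [U^k psi] outside [s]
   ([inner_split], [escape_mass]).  Taking for [s] a box of side
   [2 N] with [N ~ c K ^ (alpha / d)], a fixed proportion of the mass of [U^k psi] is, on
   average, at sites of norm at least [N], so that the p-th moment is at least
   of order [N ^ p]. *)

(** * The unit circle: angles and measurability *)

Section Circle.
Variable R : realType.
Implicit Types (a b : R) (x : borel_circle R).

Definition cis a : R[i] := cos a +i* sin a.

Lemma cisD a b : cis (a + b) = cis a * cis b.
Proof. by rewrite /cis cosD sinD; congr Complex; ring. Qed.

Lemma cis0 : cis 0 = 1.
Proof. by rewrite /cis cos0 sin0. Qed.

Lemma cisX a n : cis a ^+ n = cis (n%:R * a).
Proof.
elim: n => [|n IH]; first by rewrite expr0 mul0r cis0.
by rewrite exprS IH -cisD -[n.+1]add1n natrD mulrDl mul1r.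
Qed.

Lemma cis2pi : cis (2 * pi) = 1.
Proof. by rewrite /cis mulr_natl cos2pi sin2pi. Qed.

Lemma cmod_cis a : cmod (cis a) = 1.
Proof. by rewrite /cmod /= cos2Dsin2 sqrtr1. Qed.

Lemma cmodE (z : R[i]) : (cmod z)%:C = `|z|.
Proof. by []. Qed.

Lemma cmod_ge0 (z : R[i]) : 0 <= cmod z.
Proof. by case: z => u v; rewrite /cmod /= sqrtr_ge0. Qed.

Lemma sqr_cmod (z : R[i]) : cmod z ^+ 2 = complex.Re z ^+ 2 + complex.Im z ^+ 2.
Proof. by case: z => u v; rewrite /cmod /= sqr_sqrtr // addr_ge0 ?sqr_ge0. Qed.

Lemma abs_sin_le a : `|sin a| <= `|a|.
Proof.
wlog a0 : a / 0 <= a.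
  move=> h; have [/h //|a0] := leP 0 a.
  by rewrite -normrN -sinN -(normrN a) h // oppr_ge0 ltW.
have [|c _] := @MVT_segment R sin cos 0 a a0.
  exact/continuous_subspaceT/continuous_sin.
rewrite sin0 !subr0 => ->.
by rewrite normrM ler_piMl // ler_norml cos_geN1 cos_le1.
Qed.

(** The chord is [2 |sin ((a - b) / 2)|]. *)
Lemma cis_lipschitz a b : cmod (cis a - cis b) <= `|a - b|.
Proof.
rewrite -(ler_sqr (cmod_ge0 _) (normr_ge0 _)) sqr_cmod /=.
set h := (a - b) / 2; set m := (a + b) / 2.
have -> : a = m + h by rewrite /m /h; field.
have -> : b = m - h by rewrite /m /h; field.
rewrite !cosD !sinD sinN cosN.
have -> : (cos m * cos h - sin m * sin h - (cos m * cos h - sin m * - sin h)) ^+ 2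
  + (sin m * cos h + cos m * sin h - (sin m * cos h + cos m * - sin h)) ^+ 2
  = 4 * sin h ^+ 2 * (cos m ^+ 2 + sin m ^+ 2) by ring.
rewrite cos2Dsin2 mulr1.
have -> : m + h - (m - h) = 2 * h by ring.
rewrite normrM exprMn ger0_norm //.
have -> : (2 : R) ^+ 2 = 4 by ring.
by rewrite ler_wpM2l // -[leLHS]real_normK ?num_real // ler_sqr ?nnegrE // abs_sin_le.
Qed.

Lemma cval_norm x : complex.Re (cval x) ^+ 2 + complex.Im (cval x) ^+ 2 = 1.
Proof.
rewrite -sqr_cmod.
have -> : cmod (cval x) = 1 by case: x => z zc; exact: set_mem zc.
by rewrite expr1n.
Qed.
End Circle.

Section CircleMeasurability.
Variable R : realType.
Implicit Types (x : borel_circle R).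

Lemma lipschitz_continuous (f : R[i]^o -> R) :
  (forall z w : R[i], `|f z - f w| <= cmod (z - w)) -> continuous f.
Proof.
move=> fl z; apply/(@cvgrPdist_lt _ _ _ (nbhs z) (nbhs_filter z)) => e e0.
apply/(@nbhs_normP _ R[i]^o); exists e%:C; first by rewrite /= ltcR.
by move=> w /= zw; apply: le_lt_trans (fl z w) _; rewrite -ltcR.
Qed.

Lemma continuous_circle_measurable (f : R[i]^o -> R) :
  continuous f -> measurable_fun setT (fun x => f (cval x)).
Proof.
move=> /continuousP cf.
apply: (measurability _ (RGenOpens.measurableE R)) => _ [_ [a [b ->] <-]].
rewrite setTI; apply: sub_sigma_algebra.
have /continuousP cv := @initial_continuous (circle R) R[i]^o set_val.
have o := cv _ (cf _ (@interval_open _ (BRight a) (BLeft b) isT isT)).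
exact: o.
Qed.

Lemma measurable_Re_cval : measurable_fun setT (fun x => complex.Re (cval x)).
Proof.
apply: (@continuous_circle_measurable (fun z => complex.Re z)).
apply: lipschitz_continuous => z w; rewrite -ler_sqr ?nnegrE ?cmod_ge0//.
by rewrite sqr_cmod real_normK ?num_real //; case: z w => ? ? [? ?] /=; rewrite lerDl sqr_ge0.
Qed.

Lemma measurable_Im_cval : measurable_fun setT (fun x => complex.Im (cval x)).
Proof.
apply: (@continuous_circle_measurable (fun z => complex.Im z)).
apply: lipschitz_continuous => z w; rewrite -ler_sqr ?nnegrE ?cmod_ge0//.
by rewrite sqr_cmod real_normK ?num_real //; case: z w => ? ? [? ?] /=; rewrite lerDr sqr_ge0.
Qed.

Lemma Re_cval_bound x : -1 <= complex.Re (cval x) <= 1.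
Proof. by have := cval_norm x; rewrite -ler_norml => h; rewrite ler_norml; nra. Qed.

(** As [acos] is decreasing on [[-1, 1]], each set where it is at least [c] is
given by the condition [Re <= cos c]. *)
Lemma measurable_acos_Re :
  measurable_fun setT (fun x => acos (complex.Re (cval x))).
Proof.
apply: (measurability _ (RGenCInfty.measurableE R)) => _ [_ [c ->] <-].
rewrite setTI; have [c0|c0] := leP c 0.
  rewrite [X in measurable X](_ : _ = setT) //; apply/seteqP; split=> x //= _.
  by rewrite in_itv /= andbT (le_trans c0) // acos_ge0 // Re_cval_bound.
have [cpi|cpi] := leP c pi; last first.
  rewrite [X in measurable X](_ : _ = set0) //; apply/seteqP; split=> x //=.
  rewrite in_itv /= andbT => cx.
  by have := le_lt_trans (acos_lepi (Re_cval_bound x)) cpi; rewrite ltNge cx.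
rewrite [X in measurable X](_ : _ =
   (fun x => complex.Re (cval x)) @^-1` `]-oo, cos c]%classic); last first.
  apply/seteqP; split=> x /=; rewrite !in_itv /= andbT;
    have /andP[h1 h2] := Re_cval_bound x;
    have aitv : acos (complex.Re (cval x)) \in `[0, pi]
      by rewrite in_itv /= acos_ge0 ?acos_lepi ?h1.
    move=> cx; rewrite -[leLHS]acosK ?in_itv /= ?h1 ?h2 //.
    by rewrite leNgt ltr_cos ?in_itv /= ?(ltW c0) // -leNgt.
  move=> cx; move: cx; rewrite -[X in X <= _]acosK ?in_itv /= ?h1 ?h2 //.
  by rewrite leNgt ltr_cos ?in_itv /= ?(ltW c0) // -leNgt.
by rewrite -[X in measurable X]setTI; apply: measurable_Re_cval.
Qed.

(** The angle of a point as a fraction of a full turn, in [0, 1[. *)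
Definition turn x : R :=
  (if 0 <= complex.Im (cval x) then acos (complex.Re (cval x))
   else 2 * pi - acos (complex.Re (cval x))) / (2 * pi).

Lemma measurable_turn : measurable_fun setT turn.
Proof.
apply: measurable_funM; last exact: measurable_cst.
apply: measurable_fun_ifT; last 2 first.
- exact: measurable_acos_Re.
- by apply: measurable_funB; [exact: measurable_cst|exact: measurable_acos_Re].
apply: measurable_fun_ler; [exact: measurable_cst|exact: measurable_Im_cval].
Qed.

Lemma turn_itv x : 0 <= turn x < 1.
Proof.
have p0 := pi_gt0 R; have p2 : 0 < 2 * pi :> R by rewrite mulr_gt0.
have a0 := acos_ge0 (Re_cval_bound x); have a1 := acos_lepi (Re_cval_bound x).
rewrite /turn; case: ifPn => [_|]; last rewrite -ltNge => Im0.
  by rewrite divr_ge0 ?(ltW p2)//= ltr_pdivrMr // mul1r; lra.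
have /andP[_ h] := Re_cval_bound x.
have h1 : complex.Re (cval x) < 1 by have := cval_norm x; nra.
have g0 : 0 < acos (complex.Re (cval x)).
  by apply: acos_gt0; rewrite h1 andbT; case/andP: (Re_cval_bound x).
rewrite divr_ge0 ?(ltW p2) //=; last lra.
by rewrite ltr_pdivrMr // mul1r; lra.
Qed.

Lemma cis_turn x : cis (2 * pi * turn x) = cval x.
Proof.
have p2 : 2 * pi != 0 :> R by rewrite mulf_neq0 // gt_eqF // pi_gt0.
rewrite /turn mulrCA divff // mulr1.
have /andP[h1 h2] := Re_cval_bound x.
have E : Num.sqrt (1 - complex.Re (cval x) ^+ 2) = `|complex.Im (cval x)|.
  by rewrite -(cval_norm x) addrAC subrr add0r sqrtr_sqr.
have aK : cos (acos (complex.Re (cval x))) = complex.Re (cval x).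
  by rewrite acosK // in_itv /= h1.
rewrite /cis; case: ifPn => Im0.
  rewrite aK sin_acos ?h1 // E ger0_norm //.
  by case: (cval x).
rewrite cosB sinB !mulr_natl cos2pi sin2pi !mul0r !mul1r aK sin_acos ?h1 // E.
rewrite addr0 sub0r ltr0_norm ?opprK; last by rewrite ltNge.
by case: (cval x).
Qed.

End CircleMeasurability.

(** * Dyadic arcs *)

Section DyadicArcs.
Variable R : realType.
Implicit Types (x y : borel_circle R) (k l m : nat).

(** Arcs are numbered as the nodes of a binary heap: the arcs of level [k] have
the indices from [2 ^ k] to [2 ^ k.+1 - 1], and [n./2] is the parent of [n]. One
natural number thus gives both the level of an arc and its position, which suits
the countable covers in the definition of the Hausdorff measure. *)
Definition arc_index k x : nat := Num.truncn (2 ^+ k * (1 + turn x)).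

Definition level m : nat := trunc_log 2 m.

Definition arc m : set (borel_circle R) := [set x | arc_index (level m) x = m].

Lemma arc_indexP k x :
  ((arc_index k x)%:R <= 2 ^+ k * (1 + turn x) < (arc_index k x).+1%:R).
Proof.
apply: truncn_itv; have /andP[t0 _] := turn_itv x.
by rewrite mulr_ge0 ?exprn_ge0 // addr_ge0.
Qed.

Lemma arc_index_bounds k x : (2 ^ k <= arc_index k x < 2 ^ k.+1)%N.
Proof.
have /andP[t0 t1] := turn_itv x; have k0 : 0 < 2 ^+ k :> R by rewrite exprn_gt0.
have s0 : 0 <= 2 ^+ k * (1 + turn x) by rewrite mulr_ge0 ?(ltW k0) // addr_ge0.
rewrite /arc_index truncn_ge_nat // truncn_lt_nat // !natrX exprS; nra.
Qed.

Lemma level_arc_index k x : level (arc_index k x) = k.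
Proof. exact: trunc_log_eq (arc_index_bounds k x). Qed.

Lemma arc_arc_index k x : arc (arc_index k x) x.
Proof. by rewrite /arc /= level_arc_index. Qed.

Lemma arc_index_half k x : arc_index k x = (arc_index k.+1 x)./2.
Proof.
have /andP[t0 _] := turn_itv x.
apply: truncn_def; have := arc_indexP k.+1 x; rewrite exprS -mulrA.
set n := arc_index k.+1 x; set s := 2 ^+ k * _.
have nE : n%:R = (odd n)%:R + 2 * (n./2)%:R :> R.
  by rewrite -{1}(odd_double_half n) natrD -muln2 natrM mulrC.
rewrite -!natr1 nE.
by case: (odd n) => /= /andP[h1 h2]; apply/andP; split; lra.
Qed.

(** Arcs of different levels are nested or disjoint, because the parent of an
arc in the heap is its half. *)
Lemma arc_index_coarser k l x y :
  (k <= l)%N -> arc_index l x = arc_index l y -> arc_index k x = arc_index k y.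
Proof.
move=> /subnK <-; elim: (l - k)%N => // n IH.
by rewrite addSn => e; apply: IH; rewrite (arc_index_half _ x) (arc_index_half _ y) e.
Qed.

Lemma measurable_arc m : measurable (arc m).
Proof.
have p0 : 0 < 2 ^+ level m :> R by rewrite exprn_gt0.
rewrite [X in measurable X](_ : _ =
  (fun x => 2 ^+ level m * (1 + turn x)) @^-1` `[m%:R, m.+1%:R[%classic); last first.
  apply/seteqP; split=> x /=; rewrite in_itv /=.
    by move=> mx; have := arc_indexP (level m) x; rewrite mx.
  by move=> mx; exact: truncn_def.
rewrite -[X in measurable X]setTI.
apply: (_ : measurable_fun setT (fun x => 2 ^+ level m * (1 + turn x))) => //.
apply: measurable_funM; first exact: measurable_cst.
apply: measurable_funD; [exact: measurable_cst|exact: measurable_turn].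
Qed.

Lemma cis_turn1 x : cval x = cis (2 * pi * (1 + turn x)).
Proof. by rewrite mulrDr mulr1 cisD cis2pi mul1r cis_turn. Qed.

Definition root_of_unity k : R[i] := cis (2 * pi / 2 ^+ k).

(** The exponent can be the heap index itself, without subtracting [2 ^ level m],
because that power of the root of unity is one. *)
Lemma arc_root_of_unity m x : arc m x ->
  cmod (cval x - root_of_unity (level m) ^+ m) <= 2 * pi / 2 ^+ level m.
Proof.
rewrite /arc /= => mx; rewrite cis_turn1 cisX; apply: le_trans (cis_lipschitz _ _) _.
have := arc_indexP (level m) x; rewrite mx -natr1.
have k0 : 0 < 2 ^+ level m :> R by rewrite exprn_gt0.
move: (2 ^+ level m) k0 => e e0 /andP[h1 h2]; have p0 := pi_gt0 R.
have -> : 2 * pi * (1 + turn x) - m%:R * (2 * pi / e) =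
    2 * pi / e * (e * (1 + turn x) - m%:R) :> R by field; rewrite gt_eqF.
have c0 : 0 <= 2 * pi / e :> R by rewrite divr_ge0 // ?mulr_ge0 ?ltW.
rewrite normrM ger0_norm // ler_piMr // ger0_norm; lra.
Qed.

Lemma diam_arc (S : set (circle R)) m : S `<=` arc m -> diam S <= 4 * pi / 2 ^+ level m.
Proof.
move=> Sm; have p0 := pi_gt0 R.
have c0 : 0 <= 4 * pi / 2 ^+ level m :> R by rewrite divr_ge0 ?exprn_ge0 ?mulr_ge0 ?ltW.
rewrite /diam; set D := (X in sup X).
have [->|/set0P D0] := eqVneq D set0; first by rewrite sup0.
apply: ge_sup => // _ [x [y [/Sm mx /Sm my ->]]].
have -> : cval x - cval y = (cval x - root_of_unity (level m) ^+ m) +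
    - (cval y - root_of_unity (level m) ^+ m) by ring.
apply: le_trans (le_normcD _ _) _; rewrite normcN.
apply: le_trans (lerD (arc_root_of_unity mx) (arc_root_of_unity my)) _.
by rewrite -mulrDl; apply: ler_wpM2r; [rewrite invr_ge0 exprn_ge0|lra].
Qed.

Lemma diam_ge0 (S : set (circle R)) : 0 <= diam S.
Proof.
rewrite /diam; set D := (X in sup X).
have [[[r Dr] Dub]|/sup_out -> //] := pselect (has_sup D).
apply: le_trans (ub_le_sup Dub Dr).
by case: Dr => [x [y [_ _ ->]]]; exact: cmod_ge0.
Qed.

End DyadicArcs.

(** * Polynomials near roots of unity *)

Section LargeSieve.
Variable R : realType.
Implicit Types (z w h : R[i]) (p q : {poly R[i]}).

Lemma cmod_sum (I : Type) (r : seq I) (P : pred I) (F : I -> R[i]) :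
  cmod (\sum_(i <- r | P i) F i) <= \sum_(i <- r | P i) cmod (F i).
Proof.
apply: (big_ind2 (fun (z : R[i]) x => cmod z <= x)) => [|z x w y zx wy|//].
  by rewrite [cmod _]normc0.
by apply: le_trans (le_normcD _ _) _; exact: lerD.
Qed.

Lemma cmodX z n : cmod (z ^+ n) = cmod z ^+ n.
Proof.
elim: n => [|n IH]; first by rewrite !expr0 [LHS]normc1.
by rewrite !exprS -IH; exact: normcM.
Qed.

Lemma cmod_sqrE z : (cmod z ^+ 2)%:C = z * Num.conj z.
Proof. by rewrite -normCK -cmodE rmorphXn. Qed.

Lemma pi_le4 : pi <= 4 :> R.
Proof. by have [/andP[_ h] _] := pihalf_02_cos_pihalf R; lra. Qed.

Lemma conj_cis (a : R) : Num.conj (cis a) = (cis a)^-1.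
Proof.
apply: (mulfI (x := cis a)); first by rewrite -normr_gt0 -cmodE cmod_cis.
by rewrite -cmod_sqrE cmod_cis expr1n mulfV // -normr_gt0 -cmodE cmod_cis.
Qed.

Lemma root_of_unity_primitive k : (2 ^ k).-primitive_root (root_of_unity R k).
Proof.
have N0 : (0 < 2 ^ k)%N by rewrite expn_gt0.
have Nn : 2 ^+ k = (2 ^ k)%:R :> R by rewrite natrX.
rewrite /primitive_root_of_unity N0 /=; apply/forallP => i; apply/eqP.
apply/unity_rootP; have := ltn_ord i; rewrite leq_eqVlt => /predU1P[iN|iN].
  by rewrite iN eqxx /root_of_unity cisX -Nn mulrCA divff ?mulr1 ?cis2pi ?expf_neq0.
rewrite ltn_eqF // => /(congr1 (@complex.Re R)); rewrite /root_of_unity cisX /=.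
set a := _ * _ => ca.
have p0 := pi_gt0 R; have N0' : 0 < 2 ^+ k :> R by rewrite exprn_gt0.
have : 0 < sin (a / 2).
  apply: sin_gt0_pi; have -> : a / 2 = pi * (i.+1%:R / 2 ^+ k).
    by rewrite /a; field; rewrite gt_eqF.
  rewrite mulr_gt0 ?divr_gt0 //= -[ltRHS]mulr1 ltr_pM2l //.
  by rewrite ltr_pdivrMr // mul1r Nn ltr_nat.
have : cos (a / 2 + a / 2) = 1 by rewrite -splitr ca.
have := cos2Dsin2 (a / 2); rewrite cosD; nra.
Qed.

(** Expanding the squares leaves the geometric sums of [w ^+ i / w ^+ l], which
vanish for [i != l] as [w] is primitive. *)
Lemma root_of_unity_parseval k q : (size q <= 2 ^ k)%N ->
  \sum_(j < 2 ^ k) cmod q.[root_of_unity R k ^+ j] ^+ 2 =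
  (2 ^ k)%:R * \sum_(i < 2 ^ k) cmod q`_i ^+ 2.
Proof.
move=> qN; apply: (@complexI R); rewrite rmorphM rmorph_nat !rmorph_sum /=.
set w := root_of_unity R k; have wP := root_of_unity_primitive k.
have w0 : w != 0 by rewrite -normr_gt0 -cmodE cmod_cis.
transitivity (\sum_(j < 2 ^ k) \sum_(i < 2 ^ k) \sum_(l < 2 ^ k)
    (q`_i * Num.conj q`_l) * (w ^+ i / w ^+ l) ^+ j).
  apply: eq_bigr => j _; rewrite cmod_sqrE (horner_coef_wide _ qN) rmorph_sum.
  rewrite mulr_suml; apply: eq_bigr => i _; rewrite mulr_sumr.
  apply: eq_bigr => l _; rewrite rmorphM !rmorphXn /= conj_cis -/w.
  rewrite expr_div_n -!exprM !exprVn -[(j * l)%N]mulnC -[(j * i)%N]mulnC; ring.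
rewrite exchange_big mulr_sumr /=; apply: eq_bigr => i _.
rewrite exchange_big (bigD1 i) //= [X in _ + X]big1 ?addr0 => [|l li].
  under eq_bigr do rewrite divff ?expf_neq0 // expr1n mulr1.
  by rewrite sumr_const card_ord cmod_sqrE mulr_natl.
rewrite -mulr_sumr; set zeta := w ^+ i / w ^+ l.
have z1 : zeta - 1 != 0.
  rewrite subr_eq0; apply: contra li => /eqP e.
  have : w ^+ i == w ^+ l.
    by apply/eqP; rewrite -[RHS]mul1r -e /zeta divfK // expf_neq0.
  by rewrite (eq_prim_root_expr wP) !modn_small // eq_sym.
have : (zeta - 1) * \sum_(j < 2 ^ k) zeta ^+ j = 0.
  rewrite -subrX1 /zeta expr_div_n -!exprM ![(_ * 2 ^ k)%N]mulnC !exprM.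
  by rewrite (prim_expr_order wP) !expr1n divr1 subrr.
by move=> /eqP; rewrite mulf_eq0 (negbTE z1) => /eqP ->; rewrite mulr0.
Qed.

Lemma bin_le_expn n m : ('C(n, m) <= n ^ m)%N.
Proof.
elim: m n => [|m IH] n; first by rewrite bin0 expn0.
apply: (@leq_trans (m.+1 * 'C(n, m.+1))); first by rewrite leq_pmull.
rewrite -mul_bin_diag expnS leq_mul2l; apply/orP; right.
apply: leq_trans (IH _) _.
by case: (m) => [|m']; rewrite ?expn0 // leq_exp2r // leq_pred.
Qed.

(** Cauchy-Schwarz for the weights [2 ^ (- i)], whose sum is at most 2. *)
Lemma sqr_geometric_sum n (u : nat -> R) :
  (\sum_(i < n) 2^-1 ^+ i * u i) ^+ 2 <= 2 * \sum_(i < n) 2^-1 ^+ i * u i ^+ 2.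
Proof.
elim: n u => [|n IH] u; first by rewrite !big_ord0 expr0n mulr0.
rewrite !big_ord_recl expr0 !mul1r.
have E (v : nat -> R) : \sum_(i < n) 2^-1 ^+ lift ord0 i * v (lift ord0 i) =
    2^-1 * \sum_(i < n) 2^-1 ^+ i * v i.+1.
  rewrite mulr_sumr; apply: eq_bigr => i _.
  by rewrite lift0 exprS mulrA.
have young (a x y : R) : x ^+ 2 <= 2 * y ->
    (a + 2^-1 * x) ^+ 2 <= 2 * (a ^+ 2 + 2^-1 * y).
  by move=> xy; have := sqr_ge0 (a - x / 2); nra.
by rewrite E (E (fun i => u i ^+ 2)); exact: young (IH (fun i => u i.+1)).
Qed.

(** An upper bound for [|p|^2] on the disc of radius [1 / (2 K)] about [w]. The
i-th Taylor coefficient is divided by [K ^ i], which is the size of the binomial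
coefficients in it; the radius then makes up for [K ^ i] and leaves the summable
weight [2 ^ (- i)]. *)
Definition taylor_bound K p w : R :=
  2 * \sum_(i < K) 2^-1 ^+ i * (cmod p^`N(i).[w] / K%:R ^+ i) ^+ 2.

Lemma taylor_bound_ge0 K p w : 0 <= taylor_bound K p w.
Proof.
rewrite mulr_ge0 // sumr_ge0 // => i _.
by rewrite mulr_ge0 ?sqr_ge0 // exprn_ge0.
Qed.

Lemma le_taylor_bound K p w h : (0 < K)%N -> (size p <= K)%N ->
  cmod h <= (2 * K%:R)^-1 -> cmod p.[w + h] ^+ 2 <= taylor_bound K p w.
Proof.
move=> K0 pK hK; have K0' : 0 < K%:R :> R by rewrite ltr0n.
apply: le_trans (sqr_geometric_sum K (fun i => cmod p^`N(i).[w] / K%:R ^+ i)).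
rewrite (@nderiv_taylor_wide _ K p w h (mulrC _ _) pK).
rewrite ler_sqr ?nnegrE ?cmod_ge0 ?sumr_ge0 // => [|i _]; last first.
  by rewrite mulr_ge0 ?divr_ge0 ?exprn_ge0 ?cmod_ge0 // ler0n.
apply: le_trans (cmod_sum _ _ _) _; apply: ler_sum => i _.
rewrite [cmod _]normcM -/(cmod _) -/(cmod _) mulrCA ler_wpM2l ?cmod_ge0 //.
rewrite cmodX -exprVn -exprMn -invfM.
by apply: lerXn2r; rewrite ?nnegrE ?cmod_ge0 // invr_ge0 mulr_ge0 // ltW.
Qed.

(** By Parseval for each [p^`N(m)], whose coefficients divided by [K ^ m] are
bounded by those of [p], since ['C(m + i, m) <= K ^ m] when [m + i < K]. *)
Lemma sum_taylor_bound K p k : (0 < K)%N -> (size p <= K)%N -> (K <= 2 ^ k)%N ->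
  \sum_(j < 2 ^ k) taylor_bound K p (root_of_unity R k ^+ j) <=
  4 * ((2 ^ k)%:R * \sum_(i < 2 ^ k) cmod p`_i ^+ 2).
Proof.
move=> K0 pK Kk; have K0' : 0 < K%:R :> R by rewrite ltr0n.
rewrite -mulr_sumr exchange_big /=.
set T := \sum_(i < 2 ^ k) cmod p`_i ^+ 2.
have T0 : 0 <= (2 ^ k)%:R * T.
  by rewrite mulr_ge0 // sumr_ge0 // => i _; rewrite sqr_ge0.
have -> : 4 = 2 * 2 :> R by ring.
rewrite -mulrA ler_wpM2l //.
apply: (@le_trans _ _ (\sum_(m < K) 2^-1 ^+ m * ((2 ^ k)%:R * T))).
  apply: ler_sum => m _; rewrite -mulr_sumr ler_wpM2l ?exprn_ge0 //.
  under eq_bigr do rewrite expr_div_n.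
  rewrite -mulr_suml root_of_unity_parseval; last first.
    apply/leq_sizeP => j kj; rewrite coef_nderivn nth_default ?mul0rn //.
    by apply: leq_trans pK _; apply: leq_trans Kk _; apply: leq_trans kj (leq_addl _ _).
  rewrite -mulrA ler_wpM2l // ler_pdivrMr ?exprn_gt0 //.
  apply: (@le_trans _ _ (\sum_(i < 2 ^ k | (m + i < K)%N)
      cmod p`_(m + i) ^+ 2 * (K%:R ^+ m) ^+ 2)).
    rewrite [leRHS]big_mkcond; apply: ler_sum => i _; rewrite coef_nderivn.
    case: ifPn => [miK|]; last first.
      rewrite -leqNgt => Kmi; rewrite nth_default ?mul0rn ?[cmod _]normc0 ?expr0n //.
      exact: leq_trans pK Kmi.
    rewrite -exprMn lerXn2r ?nnegrE ?cmod_ge0 ?mulr_ge0 ?cmod_ge0 ?exprn_ge0 //.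
    rewrite [cmod _]normcMn -/(cmod _) -[leLHS]mulr_natr ler_wpM2l ?cmod_ge0 //.
    rewrite -natrX ler_nat; apply: leq_trans (bin_le_expn _ _) _.
    by case: (nat_of_ord m) miK => // m' miK; rewrite leq_exp2r // ltnW.
  rewrite -mulr_suml ler_wpM2r ?sqr_ge0 //.
  rewrite big_mkcond /T -!(big_mkord xpredT (fun i => cmod p`_i ^+ 2)).
  rewrite -(big_mkord xpredT
    (fun i => if (m + i < K)%N then cmod p`_(m + i) ^+ 2 else 0)).
  apply: (@le_trans _ _ (\sum_(m <= i < m + 2 ^ k) cmod p`_i ^+ 2)).
    rewrite [leRHS](_ : _ = \sum_(0 <= i < 2 ^ k) cmod p`_(i + m) ^+ 2); last first.
      by rewrite -{1}(add0n (m : nat)) big_addn addKn.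
    by apply: ler_sum => i _; rewrite addnC; case: ifP => // _; rewrite sqr_ge0.
  apply: (@le_trans _ _ (\sum_(0 <= i < m + 2 ^ k) cmod p`_i ^+ 2)).
    rewrite [leRHS](big_cat_nat (n := m)) ?leq_addr //= lerDr.
    by apply: sumr_ge0 => i _; rewrite sqr_ge0.
  rewrite [leLHS](big_cat_nat (n := 2 ^ k)) ?leq_addl //= gerDl.
  rewrite big_nat_cond big1 // => i /andP[/andP[ki _] _].
  rewrite nth_default ?[cmod _]normc0 ?expr0n //.
  by apply: leq_trans pK _; apply: leq_trans Kk ki.
rewrite -mulr_suml ler_wpM2r //.
elim: (K) => [|n IH]; first by rewrite big_ord0.
rewrite big_ord_recl expr0; under eq_bigr do rewrite lift0 exprS.
by rewrite -mulr_sumr; move: IH; set X := bigop _ _ _; lra.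
Qed.

End LargeSieve.

(** * Regular parts of alpha-continuous measures *)

Section RogersTaylor.
Variables (R : realType) (mu : {finite_measure set borel_circle R -> \bar R}).
Variable alpha : R.
Hypothesis alpha_ge0 : 0 <= alpha.
Implicit Types (m k n : nat) (x : borel_circle R).

Definition arc_scale k : R := (2 ^- k) `^ alpha.

(** The arcs that violate the Hölder bound with constant [n]. *)
Definition heavy n : set nat :=
  [set m | ((n%:R * arc_scale (level m))%:E < mu (arc m))%E].

Definition heavy_union n : set (borel_circle R) := \bigcup_(m in heavy n) arc m.

(** The maximal heavy arcs. As dyadic arcs are nested or disjoint they are
pairwise disjoint, which replaces a Vitali covering argument. *)
Definition first_heavy n : set nat :=
  [set m | heavy n m /\ forall x, arc m x ->
     forall k, (k < level m)%N -> ~ heavy n (arc_index k x)].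

Local Notation total := (fine (mu setT)).

Lemma mu_le_total A : measurable A -> (mu A <= total%:E)%E.
Proof.
move=> mA; rewrite fineK ?fin_num_measure //.
by apply: le_measure; rewrite ?inE //; exact: measurableT.
Qed.

Lemma arc_scale_ge0 k : 0 <= arc_scale k.
Proof. exact: powR_ge0. Qed.

Lemma arc_scale_nonincreasing k l : (k <= l)%N -> arc_scale l <= arc_scale k.
Proof.
move=> kl; apply: ge0_ler_powR; rewrite ?nnegrE ?invr_ge0 ?exprn_ge0 //.
by rewrite lef_pV2 ?posrE ?exprn_gt0 // ler_eXn2l // ltr1n.
Qed.

Lemma measurable_heavy_union n : measurable (heavy_union n).
Proof. by apply: bigcup_measurable => m _; exact: measurable_arc. Qed.

Lemma heavy_nonincreasing n n' : (n <= n')%N -> heavy n' `<=` heavy n.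
Proof.
move=> nn' m; rewrite /heavy /=; apply: le_lt_trans.
by rewrite lee_fin ler_wpM2r ?arc_scale_ge0 // ler_nat.
Qed.

Lemma heavy_union_first n : heavy_union n `<=` \bigcup_(m in first_heavy n) arc m.
Proof.
move=> x [m hm mx].
have ex : exists k, `[< heavy n (arc_index k x) >].
  by exists (level m); apply/asboolP; rewrite (mx : arc_index _ x = m).
(* The coarsest heavy arc around x has no heavy ancestor. *)
have [k /asboolP hk kmin] := ex_minnP ex.
exists (arc_index k x); last exact: arc_arc_index.
split=> // y; rewrite /arc /= level_arc_index => yx l lk hl.
have := kmin l; rewrite leqNgt lk => /(_ _)/negP; apply; last by [].
by apply/asboolP; rewrite (arc_index_coarser (ltnW lk) (esym yx)).
Qed.

Lemma trivIset_first_heavy n : trivIset (first_heavy n) (@arc R).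
Proof.
move=> m m' [hm fm] [hm' fm'] [x [mx m'x]].
have e : arc_index (level m) x = m by [].
have e' : arc_index (level m') x = m' by [].
have [mm'|m'm|mm'] := ltngtP (level m) (level m').
- by have := fm' x m'x _ mm'; rewrite e.
- by have := fm x mx _ m'm; rewrite e'.
- by rewrite -e -e' mm'.
Qed.

Lemma sum_first_heavy n :
  (\esum_(m in first_heavy n) mu (arc m) <= total%:E)%E.
Proof.
rewrite (_ : first_heavy n = [set m | m \in first_heavy n]); last first.
  by apply/seteqP; split=> m /=; rewrite inE.
rewrite -nneseries_esum => [|m _]; last exact: measure_ge0.
rewrite -measure_bigcup //; last exact: trivIset_first_heavy.
  by apply: mu_le_total; apply: bigcup_measurable => m _; exact: measurable_arc.
by move=> m _; exact: measurable_arc.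
Qed.

(** A heavy arc is short when [n] is large, since the mass of the measure is
finite. *)
Lemma level_heavy k n m : total <= n%:R * arc_scale k -> heavy n m -> (k < level m)%N.
Proof.
move=> tn; rewrite /heavy /= => hm; rewrite ltnNge; apply/negP => mk.
have := lt_le_trans hm (mu_le_total (@measurable_arc R m)).
rewrite lte_fin ltNge => /negP; apply; apply: le_trans tn _.
by rewrite ler_wpM2l // arc_scale_nonincreasing.
Qed.

(** Heaviness bounds the cost of an arc in a cover by its mass; the sum of the
masses of the disjoint arcs in [first_heavy n] is at most the total mass. *)
Lemma powR_diam_heavy n m : (0 < n)%N -> heavy n m ->
  ((diam (arc m) `^ alpha)%:E <= ((4 * pi) `^ alpha / n%:R)%:E * mu (arc m))%E.
Proof.
move=> n0 hm; have p0 : 0 <= 4 * pi :> R by rewrite mulr_ge0 // pi_ge0.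
have n0' : 0 < n%:R :> R by rewrite ltr0n.
have dm : diam (arc m) `^ alpha <= (4 * pi) `^ alpha * arc_scale (level m).
  rewrite -powRM ?invr_ge0 ?exprn_ge0 //.
  apply: ge0_ler_powR; rewrite ?nnegrE ?mulr_ge0 ?invr_ge0 ?exprn_ge0 ?pi_ge0 //.
    exact: diam_ge0.
  exact: (diam_arc (@subset_refl _ (@arc R m))).
rewrite EFinM -muleA; apply: le_trans (_ : _ <= ((4 * pi) `^ alpha * arc_scale (level m))%:E)%E _.
  by rewrite lee_fin.
rewrite EFinM; apply: lee_wpmul2l; rewrite ?lee_fin ?powR_ge0 //.
by rewrite lee_pdivlMl // -EFinM ltW.
Qed.

Lemma esumZl (I : set nat) (c : R) (f : nat -> \bar R) :
  0 <= c -> (forall m, (0 <= f m)%E) ->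
  (\esum_(m in I) (c%:E * f m) = c%:E * \esum_(m in I) f m)%E.
Proof.
move=> c0 f0; rewrite (_ : I = [set m | m \in I]); last first.
  by apply/seteqP; split=> m /=; rewrite inE.
rewrite -!nneseries_esum ?nneseriesZl // => m _.
by rewrite mule_ge0.
Qed.

Lemma hausdorff_content_heavy (delta : R) k n : 0 < delta -> (0 < n)%N ->
  4 * pi / 2 ^+ k < delta -> total <= n%:R * arc_scale k ->
  (hausdorff_content alpha delta (\bigcap_i heavy_union i) <=
   ((4 * pi) `^ alpha * total / n%:R)%:E)%E.
Proof.
move=> d0 n0 kd tn; have n0' : 0 < n%:R :> R by rewrite ltr0n.
pose s := (\esum_(m in first_heavy n) (diam (arc m) `^ alpha)%:E)%E.
apply: (@le_trans _ _ s).
  apply: ereal_inf_lbound; exists (first_heavy n), (@arc R); split=> //.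
    move=> m [hm _]; apply: le_lt_trans kd.
    apply: le_trans (diam_arc (@subset_refl _ (@arc R m))) _.
    rewrite ler_wpM2l ?mulr_ge0 ?pi_ge0 //.
    rewrite lef_pV2 ?posrE ?exprn_gt0 // ler_eXn2l ?ltr1n //.
    exact: ltnW (level_heavy tn hm).
  by move=> x /(_ n I) /heavy_union_first.
apply: (@le_trans _ _ (\esum_(m in first_heavy n)
    (((4 * pi) `^ alpha / n%:R)%:E * mu (arc m)))%E).
  by apply: le_esum => m [hm _]; exact: powR_diam_heavy.
have c0 : 0 <= (4 * pi) `^ alpha / n%:R by rewrite divr_ge0 ?powR_ge0.
by rewrite esumZl // mulrAC EFinM; apply: lee_wpmul2l (sum_first_heavy n).
Qed.

(** For every [delta] the covers by [first_heavy n] have a cost of order [1 / n],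
hence the contents vanish, and so does their limit. *)
Lemma hausdorff_measure_heavy :
  hausdorff_measure alpha (\bigcap_i heavy_union i) = 0%E.
Proof.
apply: lim_near_cst; first exact: ereal_hausdorff.
near=> delta; have d0 : 0 < delta by near: delta; exact: nbhs_right_gt.
apply/eqP; rewrite eq_le; apply/andP; split; last first.
  apply: le_ereal_inf_tmp => _ [I [S [_ _ ->]]].
  by apply: esum_ge0 => m _; rewrite lee_fin powR_ge0.
apply/lee_addgt0Pr => e e0; rewrite add0e.
set c := (4 * pi) `^ alpha * total.
have [k kd] : exists k, 4 * pi / 2 ^+ k < delta.
  (* N < 2 ^ N turns the archimedean property into smallness of 2 ^ (- N). *)
  pose N := Num.truncn (4 * pi / delta); exists N.
  have N2 : (N.+1%:R : R) <= 2 ^+ N by rewrite -natrX ler_nat ltn_expl.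
  rewrite ltr_pdivrMr ?exprn_gt0 // [delta * _]mulrC -ltr_pdivrMr //.
  exact: lt_le_trans (truncnS_gt _) N2.
have sk : 0 < arc_scale k by rewrite powR_gt0 // invr_gt0 exprn_gt0.
(* The first summand makes the heavy arcs finer than level k, the second makes
   the cost of the cover at most e. *)
pose n := (Num.truncn (total / arc_scale k) + Num.truncn (c / e)).+1.
apply: (le_trans (@hausdorff_content_heavy delta k n d0 _ kd _)) => //.
  rewrite -ler_pdivrMr //; apply: le_trans (ltW (truncnS_gt _)) _.
  by rewrite ler_nat /n ltnS leq_addr.
rewrite lee_fin -/c ler_pdivrMr // [e * _]mulrC -ler_pdivrMr //.
apply: le_trans (ltW (truncnS_gt _)) _.
by rewrite ler_nat /n ltnS leq_addl.
Unshelve. all: by end_near. Qed.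

Lemma mu_arc_diff_heavy n m :
  (mu (arc m `&` ~` heavy_union n) <= (n%:R * arc_scale (level m))%:E)%E.
Proof.
have [hm|hm] := pselect (heavy n m).
  rewrite (_ : _ `&` _ = set0) ?measure0 ?lee_fin ?mulr_ge0 ?arc_scale_ge0 //.
  by apply/seteqP; split=> // x [mx []]; exists m.
apply: le_trans (_ : mu (arc m) <= _)%E.
  apply: le_measure; rewrite ?inE; last exact: subIsetl.
    apply: measurableI; first exact: measurable_arc.
    by apply: measurableC; exact: measurable_heavy_union.
  exact: measurable_arc.
by rewrite leNgt; apply/negP.
Qed.

(** The intersection of the decreasing sets [heavy_union n] is negligible by
alpha-continuity, so some [heavy_union n] has small mass; its complement is the
set [S], and [n] is the constant [B]. *)
Lemma rogers_taylor (e : R) : alpha_continuous alpha mu -> 0 < e ->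
  exists2 S : set (borel_circle R), measurable S /\ (mu (~` S) < e%:E)%E &
  exists2 B : R, 0 <= B &
    forall m, (mu (arc m `&` S) <= (B * arc_scale (level m))%:E)%E.
Proof.
move=> ac e0.
have mE : measurable (\bigcap_i heavy_union i).
  by apply: bigcap_measurable => // i _; exact: measurable_heavy_union.
have E0 : mu (\bigcap_i heavy_union i) = 0%E.
  by apply: measure_negligible => //; apply: ac; exact: hausdorff_measure_heavy.
have : mu \o heavy_union @ \oo --> 0%E.
  rewrite -E0; apply: nonincreasing_cvg_mu => //.
  - by rewrite ltey_eq fin_num_measure //; exact: measurable_heavy_union.
  - exact: measurable_heavy_union.
  - move=> i j ij; rewrite subsetEset; apply: bigcup_subset.
    exact: heavy_nonincreasing.
move=> /fine_cvgP[_ /cvgrPdist_lt /(_ e e0)] [n _ /(_ n (leqnn n)) /=].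
rewrite sub0r normrN => mun.
exists (~` heavy_union n); first split.
- by apply: measurableC; exact: measurable_heavy_union.
- rewrite setCK -[X in (X < _)%E]fineK ?fin_num_measure //; last first.
    exact: measurable_heavy_union.
  by rewrite lte_fin; apply: le_lt_trans (ler_norm _) mun.
exists n%:R => // m; exact: mu_arc_diff_heavy.
Qed.

End RogersTaylor.

(** * Inner products and duality *)

Section Hilbert.
Variables (R : realType) (H : completeNormedModType R[i]).
Variable dot : {dot H for (@Num.conj R[i])}.
Implicit Types (x y z u v : H) (a : R[i]).

Definition norm2 x : R := complex.Re (inner dot x x).

Lemma inner_norm2 x : inner dot x x = (norm2 x)%:C.
Proof. by rewrite /norm2 RRe_real // ger0_real // dnorm_ge0. Qed.

Lemma norm2_ge0 x : 0 <= norm2 x.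
Proof. by rewrite -ler0c -inner_norm2 dnorm_ge0. Qed.

Lemma inner_conj x y : inner dot y x = Num.conj (inner dot x y).
Proof. by rewrite /inner hermC /= expr0 mul1r. Qed.

Lemma innerDr x y z : inner dot x (y + z) = inner dot x y + inner dot x z.
Proof. exact: linearDl. Qed.

Lemma innerZr x a y : inner dot x (a *: y) = a * inner dot x y.
Proof. exact: linearZl_LR. Qed.

Lemma innerBr x y z : inner dot x (y - z) = inner dot x y - inner dot x z.
Proof. exact: linearBl. Qed.

Lemma inner_sumr (I : Type) (r : seq I) (c : I -> R[i]) (f : I -> H) x :
  inner dot x (\sum_(i <- r) c i *: f i) = \sum_(i <- r) c i * inner dot x (f i).
Proof.
elim: r => [|i r IH]; first by rewrite !big_nil /inner linear0l.
by rewrite !big_cons innerDr innerZr IH.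
Qed.

Lemma innerDl x y z : inner dot (x + y) z = inner dot x z + inner dot y z.
Proof. exact: linearDr. Qed.

Lemma innerBl x y z : inner dot (x - y) z = inner dot x z - inner dot y z.
Proof. exact: linearBr. Qed.

Lemma innerZl x a y : inner dot (a *: x) y = Num.conj a * inner dot x y.
Proof. exact: linearZr_LR. Qed.

Lemma inner_suml (I : Type) (r : seq I) (c : I -> R[i]) (f : I -> H) x :
  inner dot (\sum_(i <- r) c i *: f i) x =
  \sum_(i <- r) Num.conj (c i) * inner dot (f i) x.
Proof.
elim: r => [|i r IH]; first by rewrite !big_nil /inner linear0r.
by rewrite !big_cons innerDl innerZl IH.
Qed.

Lemma cmod_inner_sym x y : cmod (inner dot y x) = cmod (inner dot x y).
Proof. by apply: (@complexI R); rewrite !cmodE inner_conj norm_conjC. Qed.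

Lemma norm2_eq0 x : norm2 x = 0 -> x = 0.
Proof.
move=> x0; apply/eqP; rewrite -(dnorm_eq0 dot) -[dot x x]/(inner dot x x).
by rewrite inner_norm2 x0.
Qed.

Lemma norm2B x y : norm2 (x - y) =
  norm2 x + norm2 y - 2 * complex.Re (inner dot x y).
Proof.
rewrite /norm2 innerBl !innerBr (inner_conj x y).
by case: (inner dot x x) (inner dot y y) (inner dot x y) => a b [c d] [e f] /=; ring.
Qed.

Lemma cauchy_schwarz x y : cmod (inner dot x y) ^+ 2 <= norm2 x * norm2 y.
Proof.
have [y0|y0] := eqVneq (norm2 y) 0.
  by rewrite (norm2_eq0 y0) /inner linear0l [cmod _]normc0 expr0n mulr_ge0 ?norm2_ge0.
have y1 : 0 < norm2 y by rewrite lt_neqAle eq_sym y0 norm2_ge0.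
rewrite (cmod_inner_sym y x); set s := inner dot y x; set t := s / (norm2 y)%:C.
have := norm2_ge0 (x - t *: y).
rewrite -ler0c -inner_norm2 innerBl !innerBr !innerZl !innerZr (inner_conj y x).
rewrite -/s !inner_norm2.
have -> : (norm2 x)%:C - t * Num.conj s - (Num.conj t * s - Num.conj t * (t * (norm2 y)%:C)) =
  (norm2 x - cmod s ^+ 2 / norm2 y)%:C.
  have cy : Num.conj (norm2 y)%:C = (norm2 y)%:C.
    by apply/CrealP; rewrite complex_real.
  rewrite rmorphB -[X in _ = _ - X]/(real_complex R (cmod s ^+ 2 / norm2 y)).
  rewrite (rmorphM (real_complex R)) (fmorphV (real_complex R)) /= cmod_sqrE.
  rewrite /t rmorphM fmorphV /= cy.
  by field; rewrite -(inj_eq (@complexI R)) in y0.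
by rewrite ler0c subr_ge0 ler_pdivrMr.
Qed.

(** A matrix and its adjoint have the same norm: take for [c] the conjugates of
the coefficients [<x, v k>], so that [<x, \sum_k c k *: v k>] is the sum to be
bounded, and apply Cauchy-Schwarz. *)
Lemma dual_bessel n (v : 'I_n -> H) (L : R) x : 0 <= L ->
  (forall c : 'I_n -> R[i],
     norm2 (\sum_k c k *: v k) <= L * \sum_k cmod (c k) ^+ 2) ->
  \sum_k cmod (inner dot x (v k)) ^+ 2 <= L * norm2 x.
Proof.
move=> L0 vL; pose c k := inner dot (v k) x; set S := \sum_k _.
have SE : \sum_k cmod (c k) ^+ 2 = S.
  by apply: eq_bigr => k _; rewrite cmod_inner_sym.
have S0 : 0 <= S by apply: sumr_ge0 => k _; rewrite sqr_ge0.
have := cauchy_schwarz x (\sum_k c k *: v k).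
have -> : inner dot x (\sum_k c k *: v k) = S%:C.
  rewrite inner_sumr -SE rmorph_sum; apply: eq_bigr => k _.
  by rewrite /= cmod_sqrE (inner_conj (v k) x).
have -> : cmod S%:C ^+ 2 = S ^+ 2 by rewrite sqr_cmod /= expr0n addr0.
have := vL c; rewrite SE => h1 h2.
have := norm2_ge0 x => x0.
have : S ^+ 2 <= (L * norm2 x) * S by apply: le_trans h2 _; nra.
have [-> _|Sn] := eqVneq S 0; first exact: mulr_ge0.
by rewrite expr2 ler_pM2r // lt_neqAle eq_sym Sn.
Qed.

End Hilbert.

(** * Bounded Borel functions and the functional calculus *)

Section BoundedBorel.
Variable R : realType.
Implicit Types (f g : borel_circle R -> R[i]) (S : set (borel_circle R)).

Lemma bounded_borel_cst (a : R[i]) : bounded_borel (fun=> a : R[i]).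
Proof. by split; [exact: measurable_cst|exact: measurable_cst|exists (cmod a)]. Qed.

Lemma bounded_borelD f g : bounded_borel f -> bounded_borel g ->
  bounded_borel (fun t => f t + g t).
Proof.
move=> [fr fi [M fM]] [gr gi [N gN]]; split.
- rewrite (_ : (fun _ => _) = fun t => complex.Re (f t) + complex.Re (g t)).
    exact: measurable_funD.
  by apply/funext => t; case: (f t) (g t) => ? ? [].
- rewrite (_ : (fun _ => _) = fun t => complex.Im (f t) + complex.Im (g t)).
    exact: measurable_funD.
  by apply/funext => t; case: (f t) (g t) => ? ? [].
- by exists (M + N) => t; apply: le_trans (le_normcD _ _) (lerD (fM t) (gN t)).
Qed.

Lemma bounded_borelM f g : bounded_borel f -> bounded_borel g ->
  bounded_borel (fun t => f t * g t).
Proof.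
move=> [fr fi [M fM]] [gr gi [N gN]]; split.
- rewrite (_ : (fun _ => _) = fun t => complex.Re (f t) * complex.Re (g t) -
      complex.Im (f t) * complex.Im (g t)).
    by apply: measurable_funB; exact: measurable_funM.
  by apply/funext => t; case: (f t) (g t) => ? ? [].
- rewrite (_ : (fun _ => _) = fun t => complex.Re (f t) * complex.Im (g t) +
      complex.Im (f t) * complex.Re (g t)).
    by apply: measurable_funD; exact: measurable_funM.
  by apply/funext => t; case: (f t) (g t) => ? ? [].
- exists (M * N) => t; rewrite [cmod _]normcM -/(cmod _) -/(cmod _).
  by apply: ler_pM => //; exact: cmod_ge0.
Qed.

Lemma bounded_borel_conj f : bounded_borel f ->
  bounded_borel (fun t => Num.conj (f t)).
Proof.
move=> [fr fi [M fM]]; split.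
- rewrite (_ : (fun _ => _) = fun t => complex.Re (f t)) //.
  by apply/funext => t; case: (f t).
- rewrite (_ : (fun _ => _) = fun t => - complex.Im (f t)).
    exact: measurable_funN.
  by apply/funext => t; case: (f t).
- exists M => t; suff -> : cmod (Num.conj (f t)) = cmod (f t) by [].
  by apply: (@complexI R); rewrite !cmodE norm_conjC.
Qed.

Lemma bounded_borel_indic S : measurable S ->
  bounded_borel (fun t => (\1_S t)%:C : R[i]).
Proof.
move=> mS; split; [exact: measurable_indic|exact: measurable_cst|].
exists 1 => t; rewrite /cmod /= expr0n addr0 sqrtr_sqr indicE.
by case: (_ \in _); rewrite /= ?normr1 ?normr0.
Qed.

Lemma bounded_borel_cval : bounded_borel (fun t => cval t : R[i]).
Proof.
split; [exact: measurable_Re_cval|exact: measurable_Im_cval|exists 1 => t].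
by rewrite cis_turn1 cmod_cis.
Qed.

Lemma bounded_borel_cvalX k : bounded_borel (fun t => cval t ^+ k : R[i]).
Proof.
elim: k => [|k IH]; first exact: bounded_borel_cst.
under eq_fun do rewrite exprS.
exact: bounded_borelM bounded_borel_cval IH.
Qed.

Lemma bounded_borel_sum n (f : 'I_n -> borel_circle R -> R[i]) (c : 'I_n -> R[i]) :
  (forall k, bounded_borel (f k)) ->
  bounded_borel (fun t => \sum_k c k * f k t).
Proof.
elim: n f c => [|n IH] f c bf.
  by under eq_fun do rewrite big_ord0; exact: bounded_borel_cst.
under eq_fun do rewrite big_ord_recl.
by apply: bounded_borelD; [apply: bounded_borelM => //; exact: bounded_borel_cst|exact: IH].
Qed.

End BoundedBorel.

Section Calculus.
Variables (R : realType) (H : completeNormedModType R[i]).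
Variable dot : {dot H for (@Num.conj R[i])}.
Variables (U : H -> H) (F : (borel_circle R -> R[i]) -> H -> H).
Hypothesis FU : borel_calculus dot U F.

Lemma calculus0 x : F (fun=> 0) x = 0.
Proof.
have := calculusD FU (-1) (bounded_borel_cst 1) (bounded_borel_cst 1) x.
by under eq_fun do rewrite mulN1r addNr; rewrite scaleN1r addNr.
Qed.

Lemma calculus_sum n (f : 'I_n -> borel_circle R -> R[i]) (c : 'I_n -> R[i]) x :
  (forall k, bounded_borel (f k)) ->
  F (fun t => \sum_k c k * f k t) x = \sum_k c k *: F (f k) x.
Proof.
elim: n f c => [|n IH] f c bf.
  by under eq_fun do rewrite big_ord0; rewrite big_ord0 calculus0.
under eq_fun do rewrite big_ord_recl.
rewrite (calculusD FU) // ?big_ord_recl ?IH //.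
exact: bounded_borel_sum.
Qed.

Lemma calculus_iter k x : F (fun t => cval t ^+ k) x = iter k U x.
Proof.
elim: k => [|k IH]; first exact: (calculus1 FU).
under eq_fun do rewrite exprS.
rewrite (calculusM FU); [|exact: bounded_borel_cval|exact: bounded_borel_cvalX].
by rewrite IH (calculus_id FU).
Qed.

(** The spectral theorem seen from one vector: [f |-> f(U) y] is isometric for the
square norm of [mu], because [f(U)] has the adjoint given by the conjugate of [f]. *)
Lemma norm2_calculus (mu : {finite_measure set borel_circle R -> \bar R}) y f :
  (forall g, bounded_borel g -> inner dot y (F g y) = Cintegral mu g) ->
  bounded_borel f ->
  norm2 dot (F f y) = \int[mu]_t (cmod (f t) ^+ 2).
Proof.
move=> Fmu bf; have bf' := bounded_borel_conj bf.
rewrite /norm2 (calculus_adj FU) // -(calculusM FU) // Fmu; last exact: bounded_borelM.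
rewrite /Cintegral /=; congr Rintegral; apply/funext => t.
by rewrite mulrC -cmod_sqrE.
Qed.

Lemma calculus_orbit_sum K (c : 'I_K -> R[i]) (S : set (borel_circle R)) y :
  measurable S ->
  \sum_k c k *: iter k U (F (fun t => (\1_S t)%:C) y) =
  F (fun t => (\sum_k c k * cval t ^+ k) * (\1_S t)%:C) y.
Proof.
move=> mS.
rewrite (calculusM FU); last 2 first.
- by apply: bounded_borel_sum => k; exact: bounded_borel_cvalX.
- exact: bounded_borel_indic.
rewrite calculus_sum => [|k]; last exact: bounded_borel_cvalX.
by apply: eq_bigr => k _; rewrite calculus_iter.
Qed.

End Calculus.

(** * The large sieve inequality *)

Section DecayOfAverages.
Variables (R : realType) (mu : {finite_measure set borel_circle R -> \bar R}).
Implicit Types (S : set (borel_circle R)).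

Lemma Rintegral_le_step n (A : 'I_n -> set (borel_circle R)) (c b : 'I_n -> R)
    (f : borel_circle R -> R) :
  measurable_fun setT f -> (forall t, 0 <= f t) ->
  (forall j, measurable (A j)) -> (forall j, 0 <= c j) ->
  (forall j, (mu (A j) <= (b j)%:E)%E) ->
  (forall t, f t <= \sum_j c j * \1_(A j) t) ->
  \int[mu]_t (f t) <= \sum_j c j * b j.
Proof.
move=> mf f0 mA c0 Ab fc.
have le1 : (\int[mu]_t (f t)%:E <= (\sum_j c j * b j)%:E)%E.
  apply: (@le_trans _ _ (\int[mu]_t \sum_j ((c j)%:E * (\1_(A j) t)%:E))%E).
    apply: ge0_le_integral => //.
    - by move=> t _; rewrite lee_fin.
    - exact/measurable_EFinP.
    - by apply: emeasurable_sum => j; apply: emeasurable_funM;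
        [exact: measurable_cst|exact/measurable_EFinP/measurable_indic].
    - move=> t _; under eq_bigr do rewrite -EFinM.
      by rewrite sumEFin lee_fin.
  rewrite ge0_integral_sum //; last 2 first.
  - move=> j; apply: emeasurable_funM; first exact: measurable_cst.
    exact/measurable_EFinP/measurable_indic.
  - by move=> j t _; rewrite -EFinM lee_fin mulr_ge0.
  rewrite -sumEFin; apply: lee_sum => j _.
  rewrite ge0_integralZl //; last 2 first.
  - exact/measurable_EFinP/measurable_indic.
  - by rewrite lee_fin.
  rewrite integral_indic // setIT EFinM.
  by apply: lee_wpmul2l (Ab j); rewrite lee_fin.
rewrite /Rintegral -lee_fin fineK // ge0_fin_numE.
  by apply: le_lt_trans le1 _; rewrite ltry.
by apply: integral_ge0 => t _; rewrite lee_fin.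
Qed.

Lemma exists_arc k (t : borel_circle R) :
  exists j : 'I_(2 ^ k), arc (2 ^ k + j) t /\
    cmod (cval t - root_of_unity R k ^+ j) <= 2 * pi / 2 ^+ k.
Proof.
have /andP[h1 h2] := arc_index_bounds k t.
have jP : (arc_index k t - 2 ^ k < 2 ^ k)%N.
  by rewrite ltn_subLR // addnn -mul2n -expnS.
exists (Ordinal jP) => /=; rewrite subnKC //; split; first exact: arc_arc_index.
have := arc_root_of_unity (arc_arc_index k t); rewrite level_arc_index.
rewrite -{1}(subnKC h1) exprD.
by rewrite (prim_expr_order (root_of_unity_primitive R k)) mul1r.
Qed.

Lemma level_arc k (j : 'I_(2 ^ k)) : level (2 ^ k + j) = k.
Proof.
apply: trunc_log_eq => //; rewrite leq_addr /= expnS mul2n -addnn ltn_add2l.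
exact: ltn_ord.
Qed.

(** On each arc of level [k] the squared modulus of [p] is at most the Taylor
bound at the root of unity of the arc, and the part of the arc in [S] has mass at
most [B * arc_scale alpha k]. The points of an arc are within
[2 pi / 2 ^ k <= 8 / 2 ^ k] of its root of unity, and the factor 16 puts them in
the disc of radius [1 / (2 K)] where that bound holds. *)
Lemma large_sieve (alpha B : R) S K k (p : {poly R[i]}) :
  measurable S -> 0 <= B ->
  (forall m, (mu (arc m `&` S) <= (B * arc_scale alpha (level m))%:E)%E) ->
  (0 < K)%N -> (16 * K <= 2 ^ k)%N -> (size p <= K)%N ->
  \int[mu]_t (cmod (p.[cval t] * (\1_S t)%:C) ^+ 2) <=
  B * arc_scale alpha k * (4 * ((2 ^ k)%:R * \sum_(i < 2 ^ k) cmod p`_i ^+ 2)).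
Proof.
move=> mS B0 SB K0 Kk pK.
have Kk' : (K <= 2 ^ k)%N by apply: leq_trans Kk; rewrite leq_pmull.
apply: (@le_trans _ _ (\sum_(j < 2 ^ k)
   taylor_bound K p (root_of_unity R k ^+ j) * (B * arc_scale alpha k))).
  apply: (@Rintegral_le_step _ (fun j : 'I_(2 ^ k) => arc (2 ^ k + j) `&` S)).
  - have [fr fi _] : bounded_borel (fun t : borel_circle R => p.[cval t] * (\1_S t)%:C).
      apply: bounded_borelM; last exact: bounded_borel_indic.
      under eq_fun do rewrite (horner_coef_wide _ (leqnn _)).
      by apply: bounded_borel_sum => i; exact: bounded_borel_cvalX.
    under eq_fun do rewrite sqr_cmod.
    by apply: measurable_funD; exact: measurable_funX.
  - by move=> t; rewrite sqr_ge0.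
  - by move=> j; apply: measurableI => //; exact: measurable_arc.
  - by move=> j; exact: taylor_bound_ge0.
  - by move=> j; have := SB (2 ^ k + j)%N; rewrite level_arc.
  move=> t; have [j [jt tj]] := exists_arc k t.
  rewrite (bigD1 j) //= -[leLHS]addr0; apply: lerD; last first.
    by apply: sumr_ge0 => i _; rewrite mulr_ge0 ?taylor_bound_ge0.
  rewrite indicI /= [X in _ * (X * _)]indicE mem_set // mul1r.
  rewrite [cmod _]normcM -/(cmod _) -/(cmod _) exprMn.
  have -> : cmod ((\1_S t : R)%:C) ^+ 2 = (\1_S t : R).
    by rewrite sqr_cmod /= indicE expr0n addr0; case: (_ \in _); rewrite ?expr1n ?expr0n.
  rewrite ler_wpM2r //.
  rewrite -(subrK (root_of_unity R k ^+ j) (cval t)) addrC.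
  apply: le_taylor_bound => //; apply: le_trans tj _.
  have K0' : 0 < K%:R :> R by rewrite ltr0n.
  have k0 : 0 < 2 ^+ k :> R by rewrite exprn_gt0.
  rewrite ler_pdivrMr // [leRHS]mulrC ler_pdivlMr ?mulr_gt0 //.
  have : 16 * K%:R <= 2 ^+ k :> R by rewrite -natrX -natrM ler_nat.
  have := pi_le4 R; have := pi_ge0 R; nra.
rewrite -mulr_suml mulrC ler_wpM2l ?mulr_ge0 ?powR_ge0 //.
exact: sum_taylor_bound.
Qed.

End DecayOfAverages.

(** * Decay of averages along an orbit *)

Section OrbitDecay.
Variables (R : realType) (H : completeNormedModType R[i]).
Variable dot : {dot H for (@Num.conj R[i])}.
Variables (U : H -> H) (F : (borel_circle R -> R[i]) -> H -> H).
Hypothesis FU : borel_calculus dot U F.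
Variables (mu : {finite_measure set borel_circle R -> \bar R}) (y : H).
Hypothesis Fmu :
  forall g, bounded_borel g -> inner dot y (F g y) = Cintegral mu g.
Variables (alpha B : R) (S : set (borel_circle R)).
Hypotheses (alpha_ge0 : 0 <= alpha) (mS : measurable S) (B_ge0 : 0 <= B).
Hypothesis holder :
  forall m, (mu (arc m `&` S) <= (B * arc_scale alpha (level m))%:E)%E.

Lemma norm2_orbit_sum K k (c : 'I_K -> R[i]) : (0 < K)%N -> (16 * K <= 2 ^ k)%N ->
  norm2 dot (\sum_i c i *: iter i U (F (fun t => (\1_S t)%:C) y)) <=
  B * arc_scale alpha k * 4 * (2 ^ k)%:R * \sum_i cmod (c i) ^+ 2.
Proof.
move=> K0 Kk; pose c' i := oapp c 0 (insub i).
have c'E (i : 'I_K) : c' i = c i by rewrite /c' valK.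
pose p := \poly_(i < K) c' i.
have pK : (size p <= K)%N by exact: size_poly.
have bp : bounded_borel (fun t : borel_circle R => \sum_i c i * cval t ^+ i).
  by apply: bounded_borel_sum => i; exact: bounded_borel_cvalX.
rewrite (calculus_orbit_sum FU) // (norm2_calculus FU Fmu); last first.
  by apply: bounded_borelM => //; exact: bounded_borel_indic.
rewrite (_ : (fun t => _) = fun t => cmod (p.[cval t] * (\1_S t)%:C) ^+ 2).
  apply: le_trans (large_sieve mS B_ge0 holder K0 Kk pK) _.
  have Kk' : (K <= 2 ^ k)%N by apply: leq_trans Kk; rewrite leq_pmull.
  rewrite -!mulrA !(ler_wpM2l, powR_ge0) //.
  rewrite (eq_bigr (fun i : 'I_K => cmod p`_i ^+ 2)) => [|i _]; last first.
    by rewrite coef_poly ltn_ord c'E.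
  rewrite (big_ord_widen _ (fun i => cmod p`_i ^+ 2) Kk') [leRHS]big_mkcond.
  apply: ler_sum => i _; case: ifPn => //; rewrite -leqNgt => Ki.
  by rewrite nth_default ?[cmod _]normc0 ?expr0n //; exact: leq_trans pK Ki.
apply/funext => t; rewrite horner_poly.
by under [in RHS]eq_bigr do rewrite c'E.
Qed.

(** The level [k] is chosen with [16 K < 2 ^ k <= 32 K], so that
[2 ^ k * arc_scale alpha k] is of order [K / K ^ alpha]. *)
Lemma orbit_decay K x : (0 < K)%N ->
  \sum_(k < K) cmod (inner dot x (iter k U (F (fun t => (\1_S t)%:C) y))) ^+ 2 <=
  128 * B * (K%:R / K%:R `^ alpha) * norm2 dot x.
Proof.
move=> K0; have K16 : (0 < 16 * K)%N by rewrite muln_gt0.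
have /andP[k1 k2] := trunc_log_bounds (p := 2) isT K16.
set k := (trunc_log 2 (16 * K)).+1 in k2.
have K0' : 0 < K%:R :> R by rewrite ltr0n.
have k0 : 0 < 2 ^+ k :> R by rewrite exprn_gt0.
have sk : arc_scale alpha k <= (K%:R `^ alpha)^-1.
  rewrite -(powR_inv1 (powR_ge0 _ _)) powRAC powR_inv1 ?ler0n //.
  apply: ge0_ler_powR; rewrite ?nnegrE ?invr_ge0 ?exprn_ge0 ?ler0n //.
  rewrite lef_pV2 ?posrE // -natrX ler_nat; lia.
have k32 : (2 ^ k)%:R <= 32 * K%:R :> R.
  by rewrite -natrM ler_nat /k expnS; lia.
have L0 : 0 <= B * arc_scale alpha k * 4 * (2 ^ k)%:R by rewrite !mulr_ge0 ?powR_ge0.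
have := dual_bessel (v := fun i : 'I_K => iter i U _) x L0
  (fun c => norm2_orbit_sum c K0 (ltnW k2)).
move=> h; apply: le_trans h _.
rewrite ler_wpM2r ?norm2_ge0 //.
have -> : 128 * B * (K%:R / K%:R `^ alpha) =
   B * (K%:R `^ alpha)^-1 * 4 * (32 * K%:R) by ring.
apply: ler_pM => //; first by rewrite !mulr_ge0 ?powR_ge0.
by rewrite ler_wpM2r // ler_wpM2l.
Qed.

End OrbitDecay.

(** * Orthonormal bases *)

Section OrthonormalBasis.
Variables (R : realType) (H : completeNormedModType R[i]).
Variable dot : {dot H for (@Num.conj R[i])}.
Hypothesis Hdot : norm_from_inner dot.
Variables (I : choiceType) (A : set I) (e : I -> H).
Hypothesis eB : orthonormal_basis dot A e.
Implicit Types (u v : H) (s : seq I) (c : I -> R[i]).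

Lemma inner_basis_comb s c i : uniq s -> {in s, forall j, A j} -> i \in s ->
  inner dot (e i) (\sum_(j <- s) c j *: e j) = c i.
Proof.
move=> us sA si; rewrite inner_sumr (bigD1_seq i) //= big_seq_cond big1 => [|j].
  by rewrite (eB.1 _ _ (sA _ si) (sA _ si)) eqxx mulr1 addr0.
move=> /andP[sj ji].
by rewrite (eB.1 _ _ (sA _ si) (sA _ sj)) eq_sym (negbTE ji) mulr0.
Qed.

Lemma norm2_basis_comb s c : uniq s -> {in s, forall j, A j} ->
  norm2 dot (\sum_(j <- s) c j *: e j) = \sum_(j <- s) cmod (c j) ^+ 2.
Proof.
move=> us sA; apply: (@complexI R); rewrite -inner_norm2 inner_suml rmorph_sum.
rewrite big_seq [RHS]big_seq; apply: eq_bigr => j sj.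
by rewrite inner_basis_comb //= cmod_sqrE mulrC.
Qed.

(** Pythagoras, with the coefficients [c] compared to the Fourier coefficients.
With [c] the Fourier coefficients it computes the distance to the projection, and
in general it shows that the projection is the best approximation. *)
Lemma norm2_residual s c v : uniq s -> {in s, forall j, A j} ->
  norm2 dot (v - \sum_(j <- s) c j *: e j) =
  norm2 dot v - \sum_(j <- s) cmod (inner dot (e j) v) ^+ 2 +
  \sum_(j <- s) cmod (c j - inner dot (e j) v) ^+ 2.
Proof.
move=> us sA; rewrite norm2B norm2_basis_comb // inner_sumr.
rewrite (raddf_sum (@complex.Re R)) mulr_sumr -!addrA; congr (_ + _).
rewrite -[in LHS]sumrN -[in RHS]sumrN -!big_split; apply: eq_bigr => j _ /=.
rewrite (inner_conj dot (e j) v) !sqr_cmod.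
by case: (c j) (inner dot (e j) v) => a b [f g] /=; ring.
Qed.

Lemma parseval_approx v (eps : R) : 0 < eps ->
  exists s, [/\ uniq s, {in s, forall j, A j} &
    norm2 dot v <= \sum_(j <- s) cmod (inner dot (e j) v) ^+ 2 + eps].
Proof.
move=> eps0; have r0 : 0 < (Num.sqrt eps)%:C :> R[i] by rewrite ltcR sqrtr_gt0.
have [x [vx [s [c [sA xE]]]]] : (ball v (Num.sqrt eps)%:C)^° `&` lin_span A e !=set0.
  apply: eB.2; last exact: open_interior.
  by exists v; exact: nbhsx_ballx.
(* A vector of the span may repeat an index; its coefficients are collected. *)
exists (undup s); split; first exact: undup_uniq.
  by move=> j; rewrite mem_undup; exact: sA.
have {xE} xE : x = \sum_(j <- undup s) (c j *+ count_mem j s) *: e j.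
  rewrite xE -big_undup_iterop_count; apply: eq_bigr => j _.
  by rewrite -scalerMnl.
move: vx => /interior_subset; rewrite -ball_normE /= => vx.
have sA' : {in undup s, forall j, A j} by move=> j; rewrite mem_undup; exact: sA.
have := norm2_residual (fun j => c j *+ count_mem j s) v (undup_uniq s) sA'.
rewrite -xE => E.
have vx2 : norm2 dot (v - x) <= eps.
  rewrite -lecR -inner_norm2 -Hdot -[eps in leRHS](sqr_sqrtr (ltW eps0)) rmorphXn.
  by apply: lerXn2r; rewrite ?nnegrE ?(ltW r0) ?normr_ge0 ?(ltW vx).
have : 0 <= \sum_(j <- undup s) cmod (c j *+ count_mem j s - inner dot (e j) v) ^+ 2.
  by apply: sumr_ge0 => j _; rewrite sqr_ge0.
lra.
Qed.

(** With [P] the projection on the span of [s], the inner product is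
[<P u, v> + <u, v - P v>]; both terms are bounded by Cauchy-Schwarz. *)
Lemma inner_split s u v : uniq s -> {in s, forall j, A j} ->
  cmod (inner dot u v) ^+ 2 <=
  2 * (\sum_(j <- s) cmod (inner dot (e j) u) ^+ 2) * norm2 dot v +
  2 * norm2 dot u *
    (norm2 dot v - \sum_(j <- s) cmod (inner dot (e j) v) ^+ 2).
Proof.
move=> us sA; set P := fun w : H => \sum_(j <- s) inner dot (e j) w *: e j.
have rv : norm2 dot (v - P v) =
    norm2 dot v - \sum_(j <- s) cmod (inner dot (e j) v) ^+ 2.
  rewrite norm2_residual // [X in _ + X]big1 ?addr0 // => j _.
  by rewrite subrr [cmod _]normc0 expr0n.
have -> : inner dot u v = inner dot (P u) v + inner dot u (v - P v).
  have PE : inner dot (P u) v = inner dot u (P v).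
    rewrite inner_sumr inner_suml; apply: eq_bigr => j _.
    by rewrite mulrC (inner_conj dot (e j) u).
  by rewrite innerBr PE addrC subrK.
have h1 := cauchy_schwarz dot (P u) v.
have h2 := cauchy_schwarz dot u (v - P v).
rewrite norm2_basis_comb // in h1; rewrite rv in h2.
have h3 := le_normcD (inner dot (P u) v) (inner dot u (v - P v)).
have := cmod_ge0 (inner dot (P u) v + inner dot u (v - P v)).
have young (a b f : R) : 0 <= a -> a <= b + f -> a ^+ 2 <= 2 * b ^+ 2 + 2 * f ^+ 2.
  by move=> a0 abf; have := sqr_ge0 (b - f); nra.
by move=> /young /(_ h3) h; apply: le_trans h _; rewrite -!mulrA; apply: lerD;
  rewrite ler_wpM2l.
Qed.

(** The mass of [v] outside [s] is carried by sites of weight at least [b]. Only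
finite subsums enter, through [parseval_approx]. *)
Lemma esum_basis_ge (w : I -> R) s v (b : R) :
  uniq s -> {in s, forall j, A j} -> 0 <= b ->
  (forall j, 0 <= w j) -> (forall j, A j -> j \notin s -> b <= w j) ->
  ((b * (norm2 dot v - \sum_(j <- s) cmod (inner dot (e j) v) ^+ 2))%:E <=
   \esum_(j in A) (w j * cmod (inner dot (e j) v) ^+ 2)%:E)%E.
Proof.
move=> us sA b0 w0 bw; apply/lee_addgt0Pr => d d0.
have eps0 : 0 < d / (b + 1) by rewrite divr_gt0 // ltr_wpDl.
have [t [ut tA vt]] := parseval_approx v eps0.
apply: (@le_trans _ _ ((\sum_(j <- t) w j * cmod (inner dot (e j) v) ^+ 2)%:E + d%:E)%E).
  rewrite -EFinD lee_fin; pose a j := cmod (inner dot (e j) v) ^+ 2.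
  have a0 j : 0 <= a j by exact: sqr_ge0.
  have bd : b * (d / (b + 1)) <= d.
    by rewrite mulrA ler_pdivrMr ?ltr_wpDl // mulrC ler_wpM2l ?(ltW d0) // lerDl.
  apply: (@le_trans _ _ (b * (\sum_(j <- t) a j - \sum_(j <- s) a j) + d)).
    apply: le_trans (_ : _ <= b * (\sum_(j <- t) a j - \sum_(j <- s) a j) +
      b * (d / (b + 1))) _; last by rewrite lerD2l.
    by rewrite -mulrDr ler_wpM2l // [leRHS]addrAC lerD2r.
  rewrite lerD2r.
  have ts : \sum_(j <- t) a j - \sum_(j <- s) a j <=
      \sum_(j <- t | j \notin s) a j.
    rewrite lerBlDr (bigID (mem s)) /= addrC lerD2l -big_filter.
    rewrite [leRHS](bigID (mem t)) /= -[leLHS]addr0; apply: lerD; last first.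
      by apply: sumr_ge0 => j _; exact: a0.
    rewrite -[leRHS]big_filter (perm_big [seq j <- s | j \in t]) //=.
    by apply: uniq_perm; rewrite ?filter_uniq // => j; rewrite !mem_filter andbC.
  apply: le_trans (ler_wpM2l b0 ts) _; rewrite mulr_sumr.
  rewrite [leRHS](bigID (mem s)) /= -[leLHS]add0r; apply: lerD.
    by apply: sumr_ge0 => j _; rewrite mulr_ge0 ?sqr_ge0.
  rewrite [leLHS]big_seq_cond [leRHS]big_seq_cond.
  apply: ler_sum => j /andP[tj js].
  by rewrite ler_wpM2r ?sqr_ge0 // bw //; exact: tA.
apply: leeD => //; apply: esum_ge; exists [set` t].
  split; first exact: finite_seq.
  exact: tA.
by rewrite -fsbig_seq // sumEFin.
Qed.

End OrthonormalBasis.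

(** * Sites, moments and escape of mass *)

Section LatticeBall.
Variable d : nat.

(** The box of the sites in [A] with coordinates in [[-N, N[[. *)
Lemma lattice_box (A : set {ffun 'I_d -> int}) (N : nat) :
  exists s : seq {ffun 'I_d -> int}, [/\ uniq s, {in s, forall n, A n},
    (forall n, A n -> n \notin s -> (N <= site_norm n)%N) &
    (size s <= (2 * N) ^ d)%N].
Proof.
pose shift (g : {ffun 'I_d -> 'I_(2 * N)}) : {ffun 'I_d -> int} :=
  [ffun i => (g i : nat)%:Z - N%:Z].
exists (undup [seq n <- codom shift | `[< A n >]]); split.
- exact: undup_uniq.
- by move=> n; rewrite mem_undup mem_filter => /andP[/asboolP].
- move=> n An; rewrite mem_undup mem_filter negb_and; case/orP=> [/asboolP//|].
  rewrite leqNgt; apply: contra => nN.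
  have ni i : (`|n i| < N)%N.
    by apply: leq_ltn_trans nN; rewrite /site_norm (bigD1 i) //= leq_addr.
  have gP i : (`|(n i + N%:Z)%R| < 2 * N)%N by have := ni i; lia.
  apply/codomP; exists [ffun i => Ordinal (gP i)].
  apply/ffunP => i; rewrite !ffunE /=.
  by have := ni i; lia.
apply: leq_trans (size_undup _) _; rewrite size_filter.
apply: leq_trans (count_size _ _) _.
by rewrite size_codom card_ffun !card_ord.
Qed.

End LatticeBall.

Section Dynamics.
Variables (R : realType) (H : completeNormedModType R[i]).
Variable dot : {dot H for (@Num.conj R[i])}.
Hypothesis Hdot : norm_from_inner dot.

Lemma inner_iter (U : H -> H) k x y :
  (forall x y, inner dot (U x) (U y) = inner dot x y) ->
  inner dot (iter k U x) (iter k U y) = inner dot x y.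
Proof. by move=> UU; elim: k => //= k <-; exact: UU. Qed.

Lemma norm2_unit x : `|x| = 1 -> norm2 dot x = 1.
Proof.
by move=> x1; apply: (@complexI R); rewrite -inner_norm2 -Hdot x1 expr1n.
Qed.

(** The bound [((N + 1) / 2) ^ p] is below the weight [|n| ^ p + 1] as soon as
[N <= |n|], including [N = 0]; it keeps the final estimate uniform in [N] when the
real number of which [N] is the integer part is less than one. *)
Lemma moment_ge d (A : set {ffun 'I_d -> int}) e (U : H -> H) psi (p : R) k N s :
  orthonormal_basis dot A e -> 0 <= p ->
  uniq s -> {in s, forall n, A n} ->
  (forall n, A n -> n \notin s -> (N <= site_norm n)%N) ->
  (((N.+1%:R / 2) `^ p * (norm2 dot (iter k U psi) -
     \sum_(n <- s) cmod (inner dot (e n) (iter k U psi)) ^+ 2))%:E <=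
   moment dot A e U psi p k)%E.
Proof.
move=> eB p0 us sA Ns; rewrite /moment /site_prob.
apply: (esum_basis_ge Hdot eB) => //.
move=> n An ns; have := Ns n An ns; case: N Ns => [|N] _ Nn.
  apply: (@le_trans _ _ (1 `^ p)); last by rewrite powR1 lerDr powR_ge0.
  apply: ge0_ler_powR; rewrite ?nnegrE ?divr_ge0 //.
  by rewrite ler_pdivrMr //; lra.
apply: (@le_trans _ _ ((site_norm n)%:R `^ p)); last by rewrite lerDl.
apply: ge0_ler_powR; rewrite ?nnegrE ?divr_ge0 //.
rewrite ler_pdivrMr // -natrM ler_nat; lia.
Qed.

(** The sum over [k < K] of [inner_split] for [U^k psi1] and [U^k psi], whose
inner product does not depend on [k]. If each site of [s] is visited little by the
orbit of [psi1], then [psi] must spend a positive proportion of the time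
outside [s]. *)
Lemma escape_mass d (A : set {ffun 'I_d -> int}) e (U : H -> H) psi psi1 K s (L : R) :
  orthonormal_basis dot A e ->
  (forall x y, inner dot (U x) (U y) = inner dot x y) ->
  norm2 dot psi = 1 ->
  uniq s -> {in s, forall n, A n} ->
  (forall n, A n -> \sum_(k < K) cmod (inner dot (e n) (iter k U psi1)) ^+ 2 <= L) ->
  K%:R * cmod (inner dot psi1 psi) ^+ 2 <=
  2 * (size s)%:R * L + 2 * norm2 dot psi1 *
   \sum_(k < K) (norm2 dot (iter k U psi) -
     \sum_(n <- s) cmod (inner dot (e n) (iter k U psi)) ^+ 2).
Proof.
move=> eB UU psi_1 us sA eL.
have N1 k : norm2 dot (iter k U psi) = 1 by rewrite -psi_1 /norm2 inner_iter.
have Np k : norm2 dot (iter k U psi1) = norm2 dot psi1 by rewrite /norm2 inner_iter.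
have -> : K%:R * cmod (inner dot psi1 psi) ^+ 2 =
    \sum_(k < K) cmod (inner dot (iter k U psi1) (iter k U psi)) ^+ 2.
  under eq_bigr do rewrite inner_iter //.
  by rewrite sumr_const card_ord mulr_natl.
have step k : cmod (inner dot (iter k U psi1) (iter k U psi)) ^+ 2 <=
   2 * \sum_(n <- s) cmod (inner dot (e n) (iter k U psi1)) ^+ 2 +
   2 * norm2 dot psi1 * (norm2 dot (iter k U psi) -
     \sum_(n <- s) cmod (inner dot (e n) (iter k U psi)) ^+ 2).
  apply: le_trans (inner_split eB _ _ us sA) _.
  by rewrite Np N1 mulr1.
apply: le_trans; first by apply: ler_sum => k _; exact: step.
rewrite big_split /= -!mulr_sumr lerD2r -mulrA ler_wpM2l // exchange_big /=.
have -> : (size s)%:R * L = \sum_(n <- s) L.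
  by rewrite big_const_seq count_predT iter_addr addr0 mulr_natl.
rewrite [leLHS]big_seq [leRHS]big_seq.
by apply: ler_sum => n /sA An; exact: eL.
Qed.

End Dynamics.

(** * The regular component of a state *)

Section Reduction.
Variables (R : realType) (H : completeNormedModType R[i]).
Variable dot : {dot H for (@Num.conj R[i])}.

Lemma norm2_calculus_indic (U : H -> H) F mu y (S : set (borel_circle R)) :
  borel_calculus dot U F ->
  (forall f, bounded_borel f -> inner dot y (F f y) = Cintegral mu f) ->
  measurable S ->
  norm2 dot (F (fun t => (\1_S t)%:C) y) = fine (mu S).
Proof.
move=> FU Fmu mS; rewrite (norm2_calculus FU Fmu); last exact: bounded_borel_indic.
rewrite (_ : (fun t => _) = \1_S).
  by rewrite /Rintegral integral_indic ?setIT.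
apply/funext => t; rewrite sqr_cmod /= expr0n addr0 indicE.
by case: (_ \in _); rewrite ?expr1n ?expr0n.
Qed.

Lemma calculus_indicC (U : H -> H) F y (S : set (borel_circle R)) :
  borel_calculus dot U F -> measurable S ->
  F (fun t => (\1_S t)%:C) y + F (fun t => (\1_(~` S) t)%:C) y = y.
Proof.
move=> FU mS; rewrite -[X in X + _]scale1r -(calculusD FU).
- rewrite -[RHS](calculus1 FU); congr (F _ y); apply/funext => t.
  by rewrite mul1r -rmorphD /= !indicE in_setC; case: (_ \in _); rewrite ?addr0 ?add0r.
- exact: bounded_borel_indic.
- by apply: bounded_borel_indic; exact: measurableC.
Qed.

(** The vector [psi1] is [1_S(U) y] for the set [S] of [rogers_taylor]. As the
squared norm of [y - psi1] is the mass of the complement of [S], a small enough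
mass keeps [psi1] from being orthogonal to [psi]. *)
Lemma holder_component (U : H -> H) alpha y psi mu :
  0 <= alpha -> spectral_measure dot U y mu -> alpha_continuous alpha mu ->
  inner dot y psi != 0 ->
  exists psi1 (D : R), [/\ 0 <= D, 0 < cmod (inner dot psi1 psi) &
    forall K x, (0 < K)%N ->
      \sum_(k < K) cmod (inner dot x (iter k U psi1)) ^+ 2 <=
      D * (K%:R / K%:R `^ alpha) * norm2 dot x].
Proof.
move=> alpha0 [F FU Fmu] ac ypsi; set g := cmod (inner dot y psi).
have g0 : 0 < g by rewrite -ltcR cmodE normr_gt0.
pose q := norm2 dot psi; have q0 : 0 <= q by exact: norm2_ge0.
(* If psi1 were orthogonal to psi, then g, the modulus of <y - psi1, psi>, would
   satisfy g ^ 2 <= mu (~ S) * q. *)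
have eps0 : 0 < g ^+ 2 / (q + 1) by rewrite divr_gt0 ?exprn_gt0 // ltr_wpDl.
have [S [mS muS] [B B0 SB]] := rogers_taylor alpha0 ac eps0.
exists (F (fun t => (\1_S t)%:C) y), (128 * B); split.
- by rewrite mulr_ge0.
- rewrite -ltcR cmodE normr_gt0; apply/eqP => i0.
  have := cauchy_schwarz dot (F (fun t => (\1_(~` S) t)%:C) y) psi.
  have -> : inner dot (F (fun t => (\1_(~` S) t)%:C) y) psi = inner dot y psi.
    by rewrite -[in RHS](calculus_indicC y FU mS) innerDl i0 add0r.
  have mSC : measurable (~` S) by exact: measurableC.
  rewrite (norm2_calculus_indic FU Fmu) // -/g -/q => gq.
  have : fine (mu (~` S)) < g ^+ 2 / (q + 1).
    by rewrite -lte_fin fineK // fin_num_measure.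
  have muS0 : 0 <= fine (mu (~` S)) by exact: fine_ge0.
  rewrite ltr_pdivlMr ?ltr_wpDl //; nra.
move=> K x K0; exact: (orbit_decay FU Fmu alpha0 mS B0 SB).
Qed.

(** The projection itself is the witness: [psi - y] is orthogonal to [y]. *)
Lemma P_ac_component (U : H -> H) alpha psi : P_ac dot U alpha psi <> 0 ->
  exists2 y, H_ac dot U alpha y & inner dot y psi != 0.
Proof.
rewrite /P_ac /ortho_proj; case: xgetP => [y _ [Hy yorth] y0|//].
exists y => //; apply/eqP => yp; apply: y0; apply: (@norm2_eq0 _ _ dot).
have := yorth y Hy; rewrite innerBr yp sub0r inner_norm2 => /eqP.
by rewrite oppr_eq0 => /eqP/complexI.
Qed.

End Reduction.

(** * The lower bound on moments *)

Local Close Scope complex_scope.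

Theorem proposition3p9 (R : realType) (H : completeNormedModType R[i])
    (dot : {dot H for (@Num.conj R[i])})
    (Hdot : norm_from_inner dot) (Hsep : separable H)
    (U : {linear H -> H}) (HU : unitary_operator dot U)
    (psi : H) (psi1 : `|psi| = 1)
    (d : nat) (d_gt0 : (0 < d)%N)
    (A : set {ffun 'I_d -> int})
    (HA : A = Zplus_lattice d \/ A = [set: {ffun 'I_d -> int}])
    (phi : {ffun 'I_d -> int} -> H) (Hphi : orthonormal_basis dot A phi)
    (alpha : R) (Halpha : 0 <= alpha <= 1)
    (HP : P_ac dot U alpha psi <> 0) :
  forall p : R, 0 < p ->
  exists2 C : R, 0 < C &
    forall K : nat, (0 < K)%N ->
      ((C * K%:R `^ (alpha * p / d%:R))%:E < avg_moment dot A phi U psi p K)%E.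
Proof.
move=> p p0; have /andP[alpha0 _] := Halpha.
have [y [mu ymu ac] ypsi] := P_ac_component HP.
have [eta [D [D0 g0 etaD]]] := holder_component alpha0 ymu ac ypsi.
set g := cmod (inner dot eta psi) in g0.
have npsi : norm2 dot psi = 1 by exact: norm2_unit.
set q := norm2 dot eta.
have q0 : 0 < q.
  rewrite lt_neqAle norm2_ge0 andbT eq_sym; apply/eqP => /norm2_eq0 eta0.
  by move: g0; rewrite /g eta0 /inner linear0r [cmod _]normc0 ltxx.
have d0 : 0 < d%:R :> R by rewrite ltr0n.
(* As 2 c <= 1, its d-th power is at most 2 c; the second bound makes the
   contribution of the box at most half of g ^ 2 on average. *)
pose c := Num.min 2^-1 (g ^+ 2 / (8 * D + 1)).
have c0 : 0 < c.
  by rewrite lt_min invr_gt0 ltr0n divr_gt0 ?exprn_gt0 // ltr_wpDl // mulr_ge0.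
have c2 : 2 * c <= 1 by rewrite mulrC -ler_pdivlMr // mul1r ge_min lexx.
have cD : 8 * c * D <= g ^+ 2.
  have : c <= g ^+ 2 / (8 * D + 1) by rewrite ge_min lexx orbT.
  rewrite ler_pdivlMr ?ltr_wpDl ?mulr_ge0 //; nra.
pose C0 := (c / 2) `^ p * (g ^+ 2 / (4 * q)).
have C00 : 0 < C0 by rewrite mulr_gt0 ?powR_gt0 ?divr_gt0 ?exprn_gt0 // mulr_gt0.
(* Halving the constant gives the strict inequality. *)
exists (C0 / 2); first by rewrite divr_gt0.
move=> K K0; have K0' : 0 < K%:R :> R by rewrite ltr0n.
set r := K%:R `^ (alpha / d%:R); have r0 : 0 < r by rewrite powR_gt0.
have rd : r ^+ d = K%:R `^ alpha.
  by rewrite -powR_mulrn ?(ltW r0) // -powRrM divfK // gt_eqF.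
have rp : r `^ p = K%:R `^ (alpha * p / d%:R).
  by rewrite -powRrM mulrAC.
pose N := Num.truncn (c * r).
have /andP[N1 N2] : N%:R <= c * r < N.+1%:R by apply: truncn_itv; rewrite mulr_ge0 ?ltW.
have [s [us sA Ns ss]] := lattice_box A N.
set T := \sum_(k < K) (norm2 dot (iter k U psi) -
  \sum_(n <- s) cmod (inner dot (phi n) (iter k U psi)) ^+ 2).
have size_s : (size s)%:R <= 2 * c * K%:R `^ alpha.
  apply: (@le_trans _ _ ((2 * N%:R) ^+ d)).
    by rewrite -natrM -natrX ler_nat.
  apply: (@le_trans _ _ ((2 * c) ^+ d * r ^+ d)).
    rewrite -exprMn lerXn2r ?nnegrE ?mulr_ge0 ?(ltW c0) ?(ltW r0) //.
    by rewrite -mulrA ler_wpM2l.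
  rewrite rd ler_wpM2r ?powR_ge0 // -[leRHS]expr1.
  by apply: ler_wiXn2l => //; rewrite mulr_ge0 // ltW.
have TK : g ^+ 2 / (4 * q) * K%:R <= T.
  have L n : A n -> \sum_(k < K) cmod (inner dot (phi n) (iter k U eta)) ^+ 2 <=
      D * (K%:R / K%:R `^ alpha).
    move=> An; have := etaD K (phi n) K0.
    by rewrite /norm2 (Hphi.1 _ _ An An) eqxx mulr1.
  have := escape_mass Hphi HU.2 npsi us sA L; rewrite -/T -/g -/q => h.
  have Ka : 0 < K%:R `^ alpha by rewrite powR_gt0.
  have b1 : 2 * (size s)%:R * (D * (K%:R / K%:R `^ alpha)) <= g ^+ 2 / 2 * K%:R.
    apply: (@le_trans _ _ (2 * (2 * c * K%:R `^ alpha) * (D * (K%:R / K%:R `^ alpha)))).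
      apply: ler_wpM2r; first exact: mulr_ge0 D0 (divr_ge0 (ltW K0') (ltW Ka)).
      exact: ler_wpM2l.
    have -> : 2 * (2 * c * K%:R `^ alpha) * (D * (K%:R / K%:R `^ alpha)) =
      4 * c * D * K%:R by field; rewrite gt_eqF.
    by rewrite ler_wpM2r //; lra.
  have -> : g ^+ 2 / (4 * q) * K%:R = (g ^+ 2 * K%:R / 2) / (2 * q).
    by field; rewrite gt_eqF.
  rewrite ler_pdivrMr ?mulr_gt0 //; lra.
have b0 : 0 <= (N.+1%:R / 2) `^ p :> R by exact: powR_ge0.
have bc : (c / 2) `^ p * r `^ p <= (N.+1%:R / 2) `^ p.
  rewrite -powRM ?divr_ge0 ?(ltW c0) ?(ltW r0) //; apply: ge0_ler_powR;
    rewrite ?nnegrE ?mulr_ge0 ?divr_ge0 ?(ltW p0) ?(ltW c0) ?(ltW r0) //.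
  by rewrite mulrAC ler_pM2r ?invr_gt0 // ltW.
apply: (@lt_le_trans _ _ ((K%:R^-1)%:E * ((N.+1%:R / 2) `^ p * T)%:E)%E).
  rewrite -EFinM lte_fin -rp.
  apply: (@lt_le_trans _ _ (C0 * r `^ p)).
    rewrite ltr_pM2r ?powR_gt0 // gtr_pMr // invf_lt1 //; lra.
  rewrite ler_pdivlMl //; apply: (@le_trans _ _
    ((c / 2) `^ p * r `^ p * (g ^+ 2 / (4 * q) * K%:R))).
    by rewrite /C0; lra.
  apply: ler_pM => //; first by rewrite mulr_ge0 ?powR_ge0.
  by rewrite mulr_ge0 ?divr_ge0 ?exprn_ge0 ?mulr_ge0 ?ltW.
apply: lee_wpmul2l; first by rewrite lee_fin invr_ge0 ltW.
rewrite /T mulr_sumr -sumEFin; apply: lee_sum => k _.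
by apply: moment_ge => //; exact: ltW.
Qed.
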